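(* For the quantum group $\mathfrak{D}$ at $\mathbb{S}_3$ attached to the 12-dimensional Fomin–Kirillov algebra, the quotient $\mathsf{T}_{1,0}/\mathsf{S}(\sigma,-)$ is a simple highest-weight module of weight $(e,+)$. Therefore $\mathsf{L}(e,+)\simeq M(e,+)$ as $\mathfrak{D}(\mathbb{S}_3)$-modules. Moreover, $\mathsf{L}(e,+)\simeq\mathsf{S}(e,+)$ as $\mathfrak{D}$-modules.
   Context: $\Bbbk$ is an algebraically closed field of characteristic zero; $\sigma=(12)$, $\tau=(123)$ in $\mathbb{S}_3$, permutations composed right to left. $V=\Bbbk\{x_{(12)},x_{(23)},x_{(13)}\}$ is the Yetter–Drinfeld module over $\Bbbk\mathbb{S}_3$ with $g\cdot x_{(ij)}=\mathrm{sgn}(g)x_{g(ij)g^{-1}}$ and coaction $x_{(ij)}\mapsto(ij)\otimes x_{(ij)}$. Its Nichols algebra $\mathfrak{B}(V)$ is the 12-dimensional Fomin–Kirillov algebra (top degree 4). $\mathfrak{D}$ is the Drinfeld double of the bosonization $\mathfrak{B}(V)\#\Bbbk\mathbb{S}_3$. Explicitly, $\mathfrak{D}$ is the algebra generated by $x_{(ij)}$, $y_{(ij)}$ (transpositions $(ij)$) and $g,\delta_g$ ($g\in\mathbb{S}_3$), where the $g$ multiply as in $\mathbb{S}_3$, the $\delta_g$ are orthogonal idempotents with sum $1$, and, for distinct $i,j,k$ and $g,h\in\mathbb{S}_3$: $x_{(ij)}^2=0$, $x_{(ij)}x_{(ik)}+x_{(jk)}x_{(ij)}+x_{(ik)}x_{(jk)}=0$;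 the same relations for the $y$'s; $\delta_hg=g\delta_{g^{-1}hg}$; $gx_{(ij)}=\mathrm{sgn}(g)x_{g(ij)g^{-1}}g$; $\delta_hx_{(ij)}=x_{(ij)}\delta_{(ij)h}$; $\delta_gy_{(ij)}=y_{(ij)}\delta_{(ij)g}$; $y_{(ij)}g=\mathrm{sgn}(g)\,g\,y_{g^{-1}(ij)g}$; $y_{(ij)}x_{(ij)}+x_{(ij)}y_{(ij)}=1+(ij)(\delta_{(ij)}-\delta_e)$; $y_{(ik)}x_{(ij)}+x_{(ij)}y_{(jk)}=(ij)(\delta_{(ik)}-\delta_{(ik)(ij)})$. The $g,\delta_g$ generate the Drinfeld double $\mathfrak{D}(\mathbb{S}_3)$ of $\Bbbk\mathbb{S}_3$; $\overline V=\Bbbk\{y_{(ij)}\}$ generates $\mathfrak{B}(\overline V)$; multiplication $\mathfrak{B}(V)\otimes\mathfrak{D}(\mathbb{S}_3)\otimes\mathfrak{B}(\overline V)\to\mathfrak{D}$ is a linear isomorphism. Simple $\mathfrak{D}(\mathbb{S}_3)$-modules relevant here (''degree $h$'' means $\delta_h$ acts as identity and other $\delta$'s by $0$): $M(e,+)=\Bbbk|e\rangle$ in degree $e$ with $g$ acting by $1$; $M(\sigma,-)$ with basis $|12\rangle,|23\rangle,|13\rangle$, $|ij\rangle$ of degree $(ij)$, $g|ij\rangle=\mathrm{sgn}(g)|g(ij)g^{-1}\rangle$. A $\mathfrak{D}(\mathbb{S}_3)$-module is of weight $(g,\varrho)$ if it is isomorphic to $M(g,\varrho)$. Let $\mathfrak{D}^{\ge0}$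 be the subalgebra generated by $\mathfrak{D}(\mathbb{S}_3)$ and $\overline V$; a simple $\mathfrak{D}(\mathbb{S}_3)$-module $M(g,\varrho)$ is a $\mathfrak{D}^{\ge0}$-module with $\overline V$ acting by $0$. The Verma module is $\mathsf{M}(g,\varrho)=\mathfrak{D}\otimes_{\mathfrak{D}^{\ge0}}M(g,\varrho)=\mathfrak{B}(V)\otimes M(g,\varrho)$; write $x|h\rangle$ for $x\otimes|h\rangle$. It has a unique maximal $\mathfrak{D}$-submodule; $\mathsf{L}(g,\varrho)$ is its head and $\mathsf{S}(g,\varrho)$ its socle. A $\mathfrak{D}$-module is a highest-weight module of weight $(g,\varrho)$ if it is generated by a $\mathfrak{D}(\mathbb{S}_3)$-submodule $M$ of weight $(g,\varrho)$ with $\overline VM=0$. In $\mathsf{M}(\sigma,-)$: $\mathsf{T}_{1,0}=\Bbbk|e\rangle^1\oplus\mathsf{S}(\sigma,-)$, where $|e\rangle^1=x_{(12)}|12\rangle+x_{(23)}|23\rangle+x_{(13)}|13\rangle$; it is a $\mathfrak{D}$-submodule of $\mathsf{M}(\sigma,-)$. *)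

(* Defs.v *)
From HB Require Import structures.
From mathcomp Require Import all_boot all_order all_fingroup all_algebra.
From mathcomp Require Import boolp.
From mathcomp Require Import generic_quotient ring_quotient.
From mathcomp.multinomials Require Import monalg.

Set Implicit Arguments.
Unset Strict Implicit.
Unset Printing Implicit Defensive.

Import GRing.Theory.
Local Open Scope ring_scope.

Section Submodules.
Variables (R : nzRingType) (V : lmodType R).

Record submodule := Submodule {
  submod_pred :> {pred V};
  submod_predP : submod_closed submod_pred }.

HB.instance Definition _ (U : submodule) := GRing.isSubmodClosed.Build R V
  (submod_pred U) (GRing.submod_closed_semi (submod_predP U)).

Variable U : submodule.

Definition submod := {v : V | v \in submod_pred U}.

HB.instance Definition _ := SubChoice.on submod.
HB.instance Definition _ := [SubChoice_isSubZmodule of submod by <:].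
HB.instance Definition _ := [SubZmodule_isSubLmodule of submod by <:].

Definition quotmod := Quotient.quot (submod_pred U).
HB.instance Definition _ := EqQuotient.on quotmod.
HB.instance Definition _ := GRing.Zmodule.on quotmod.

Definition qproj (v : V) : quotmod := (\pi_quotmod v)%qT.

Lemma qprojP u v : qproj u = qproj v <-> u - v \in submod_pred U.
Proof.
by rewrite /qproj -Quotient.equivE; split=> [/eqmodP|h]; last apply/eqmodP.
Qed.

Lemma qproj_repr q : qproj (repr q) = q.
Proof. exact: reprK. Qed.

Lemma qproj_is_zmod_morphism : zmod_morphism qproj.
Proof. by move=> u v; rewrite /qproj !piE. Qed.
HB.instance Definition _ :=
  GRing.isZmodMorphism.Build V quotmod qproj qproj_is_zmod_morphism.

Definition qscale a (q : quotmod) := qproj (a *: repr q).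

Lemma qproj_scale a v : qproj (a *: v) = qscale a (qproj v).
Proof.
apply/qprojP; rewrite -scalerBr; apply/rpredZ/qprojP.
by rewrite qproj_repr.
Qed.

Fact qscaleA a b q : qscale a (qscale b q) = qscale (a * b) q.
Proof. by rewrite -[q]qproj_repr -!qproj_scale scalerA. Qed.
Fact qscale1 : left_id 1 qscale.
Proof. by move=> q; rewrite -[q]qproj_repr -!qproj_scale scale1r. Qed.
Fact qscaleDr : right_distributive qscale +%R.
Proof.
move=> a p q; rewrite -[q]qproj_repr -[p]qproj_repr -raddfD -!qproj_scale.
by rewrite scalerDr raddfD.
Qed.
Fact qscaleDl q : {morph qscale^~ q : a b / a + b}.
Proof.
by move=> a b /=; rewrite -[q]qproj_repr -!qproj_scale scalerDl raddfD.
Qed.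
HB.instance Definition _ := GRing.Zmodule_isLmodule.Build R quotmod
  qscaleA qscale1 qscaleDr qscaleDl.

HB.instance Definition _ :=
  GRing.isScalable.Build R V quotmod *:%R qproj qproj_scale.

End Submodules.

Section ModuleNotions.
Variable R : nzRingType.

Definition mod_isom (U V : lmodType R) : Prop :=
  exists f : {linear U -> V}, bijective f.

Section Span.
Variables (V : lmodType R) (P : V -> Prop).

Definition gen_submod_pred : {pred V} := fun v =>
  `[< forall U : submodule V, (forall u, P u -> u \in U) -> v \in U >].

Fact gen_submod_predP : submod_closed gen_submod_pred.
Proof.
split=> [|a u v /asboolP Pu /asboolP Pv]; apply/asboolP=> U PU.
  exact: rpred0.
by apply: (submod_predP U).2; [exact: Pu | exact: Pv].
Qed.

Definition gen_submod : submodule V := Submodule gen_submod_predP.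

End Span.

Variable V : lmodType R.

Definition is_simple : Prop :=
  (exists v : V, v != 0) /\
  forall U : submodule V, {in U, forall v, v = 0} \/ (forall v, v \in U).

Definition is_maximal (U : submodule V) : Prop :=
  (exists v, v \notin U) /\
  forall W : submodule V, {subset U <= W} ->
    {subset W <= U} \/ (forall v, v \in W).

(* The intersection of all maximal submodules; it is the unique maximal
   submodule when there is only one, as for Verma modules. *)
Definition rad_pred : {pred V} := fun v =>
  `[< forall U : submodule V, is_maximal U -> v \in U >].

Fact rad_predP : submod_closed rad_pred.
Proof.
split=> [|a u v /asboolP Pu /asboolP Pv]; apply/asboolP=> U maxU.
  exact: rpred0.
by apply: (submod_predP U).2; [exact: Pu | exact: Pv].
Qed.

Definition rad : submodule V := Submodule rad_predP.

Definition headmod := quotmod rad.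
HB.instance Definition _ := GRing.Lmodule.on headmod.

End ModuleNotions.

(* [gen_submod P] is the smallest submodule containing [P], so this is the sum of
   all simple submodules. *)
Definition socle (R : nzRingType) (V : lmodType R) : submodule V :=
  gen_submod (fun v => exists2 U : submodule V, is_simple (submod U) & v \in U).

Section Preimage.
Variables (R : nzRingType) (V : lmodType R) (T S : submodule V).

(* [quotmod (subpre T S)] is the subquotient T / S when S is contained in T. *)
Definition subpre_pred : {pred submod T} := fun v => val v \in S.

Fact subpre_predP : submod_closed subpre_pred.
Proof.
split=> [|a u v]; rewrite /subpre_pred /in_mem /=; first exact: (rpred0 S).
exact: (submod_predP S).2.
Qed.

Definition subpre : submodule (submod T) := Submodule subpre_predP.

End Preimage.

Definition restr (A B : nzRingType) (f : {rmorphism A -> B}) (V : lmodType B)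
  : Type := V.

Section Restriction.
Variables (A B : nzRingType) (f : {rmorphism A -> B}) (V : lmodType B).
Local Notation restr := (restr f V).

HB.instance Definition _ := GRing.Zmodule.on restr.

Definition restr_scale (a : A) (v : restr) : restr := f a *: (v : V).

Fact restr_scaleA a b v :
  restr_scale a (restr_scale b v) = restr_scale (a * b) v.
Proof. by rewrite /restr_scale scalerA rmorphM. Qed.
Fact restr_scale1 : left_id 1 restr_scale.
Proof. by move=> v; rewrite /restr_scale rmorph1 scale1r. Qed.
Fact restr_scaleDr : right_distributive restr_scale +%R.
Proof. by move=> a u v; rewrite /restr_scale scalerDr. Qed.
Fact restr_scaleDl v : {morph restr_scale^~ v : a b / a + b}.
Proof. by move=> a b; rewrite /restr_scale rmorphD scalerDl. Qed.
HB.instance Definition _ := GRing.Zmodule_isLmodule.Build A restr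
  restr_scaleA restr_scale1 restr_scaleDr restr_scaleDl.

End Restriction.

Definition colmod (k A : nzRingType) (n : nat)
  (r : {rmorphism A -> 'M[k]_n.+1}) : Type := 'cV[k]_n.+1.

Section ColumnModule.
Variables (k A : nzRingType) (n : nat) (r : {rmorphism A -> 'M[k]_n.+1}).
Local Notation colmod := (colmod r).

HB.instance Definition _ := GRing.Zmodule.on colmod.

Definition col_scale (a : A) (v : colmod) : colmod := r a *m v.

Fact col_scaleA a b v : col_scale a (col_scale b v) = col_scale (a * b) v.
Proof. by rewrite /col_scale rmorphM mulmxA. Qed.
Fact col_scale1 : left_id 1 col_scale.
Proof. by move=> v; rewrite /col_scale rmorph1 mul1mx. Qed.
Fact col_scaleDr : right_distributive col_scale +%R.
Proof. by move=> a u v; rewrite /col_scale mulmxDr. Qed.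
Fact col_scaleDl v : {morph col_scale^~ v : a b / a + b}.
Proof. by move=> a b; rewrite /col_scale rmorphD mulmxDl. Qed.
HB.instance Definition _ := GRing.Zmodule_isLmodule.Build A colmod
  col_scaleA col_scale1 col_scaleDr col_scaleDl.

End ColumnModule.

Lemma malg_scalerAr (k : comNzRingType) (K : monomType) (c : k)
  (u v : {malg k[K]}) : c *: (u * v) = u * (c *: v).
Proof.
rewrite -[c *: v]mul_malgC -[LHS]mul_malgC !mulrA; congr (_ * v).
rewrite !malgM_def fgmulUg fgmulgU; apply: eq_bigr => m _.
by rewrite mul1m mulm1 mulrC.
Qed.

Section FreeAlgebra.
Variables (k : comNzRingType) (gen : choiceType).

Definition falg := {malg k[{fmonom gen}]}.
HB.instance Definition _ := GRing.Lalgebra.on falg.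

Definition letter (i : gen) : falg := << fmu i >>.

Fact falg_scalerAr (c : k) (u v : falg) : c *: (u * v) = u * (c *: v).
Proof. exact: malg_scalerAr. Qed.
HB.instance Definition _ := GRing.Lalgebra_isAlgebra.Build k falg falg_scalerAr.

Definition two_sided (J : {pred falg}) : Prop :=
  zmod_closed J /\ forall a u b, u \in J -> a * u * b \in J.

Variable rel : falg -> falg -> Prop.

Definition rel_ideal_pred : {pred falg} := fun u =>
  `[< forall J : {pred falg}, two_sided J ->
        (forall a b, rel a b -> a - b \in J) -> u \in J >].

Fact rel_ideal_mul a u b : u \in rel_ideal_pred -> a * u * b \in rel_ideal_pred.
Proof.
move=> /asboolP Ju; apply/asboolP=> J tsJ relJ.
by case: (tsJ) => _; apply; exact: Ju.
Qed.

Fact rel_ideal_predP : submod_closed rel_ideal_pred.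
Proof.
split=> [|c u v Ju /asboolP Jv]; first by apply/asboolP=> J [[]].
have /asboolP Jcu : c *: u \in rel_ideal_pred.
  by have := rel_ideal_mul c%:A 1 Ju; rewrite mulr1 mulr_algl.
apply/asboolP=> J tsJ relJ; have [zJ _] := tsJ; have [_ JD] := GRing.zmod_closedD zJ.
by apply: JD; [exact: Jcu | exact: Jv].
Qed.

Definition rel_ideal : submodule falg := Submodule rel_ideal_predP.

Fact rel_idealP a b : rel a b -> a - b \in rel_ideal.
Proof. by move=> ab; apply/asboolP=> J _; apply. Qed.

End FreeAlgebra.

Section FreeAlgebraEval.
Variables (k : comNzRingType) (gen : choiceType) (A : algType k) (f : gen -> A).

Definition word_eval (m : {fmonom gen}) : A := \prod_(i <- (m : seq gen)) f i.

Fact word_eval_mmorphism : mmorphism word_eval.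
Proof.
split=> [m n|]; last by rewrite /word_eval fm1 big_nil.
by rewrite /word_eval fmM big_cat.
Qed.
HB.instance Definition _ :=
  monalg.isMultiplicative.Build {fmonom gen} A word_eval word_eval_mmorphism.

Definition falg_eval : falg k gen -> A := mmap (in_alg A) word_eval.

Fact falg_eval_zmod : zmod_morphism falg_eval.
Proof. exact: raddfB. Qed.
Fact falg_eval_monoid : monoid_morphism falg_eval.
Proof.
have [hM h1] : GRing.multiplicative falg_eval.
  apply: commr_mmap_is_multiplicative => g m m'.
  by rewrite /GRing.comm /= mulr_algl mulr_algr.
by split.
Qed.
Fact falg_eval_scale : scalable falg_eval.
Proof. by move=> c u; rewrite /falg_eval mmapZ mulr_algl. Qed.

HB.instance Definition _ :=
  GRing.isZmodMorphism.Build (falg k gen) A falg_eval falg_eval_zmod.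
HB.instance Definition _ :=
  GRing.isMonoidMorphism.Build (falg k gen) A falg_eval falg_eval_monoid.
HB.instance Definition _ :=
  GRing.isScalable.Build k (falg k gen) A *:%R falg_eval falg_eval_scale.

Lemma falg_eval_letter i : falg_eval (letter k i) = f i.
Proof.
by rewrite /falg_eval /letter mmapU /= /word_eval fmU big_seq1 scale1r mul1r.
Qed.

Lemma falg_eval_ideal (rel : falg k gen -> falg k gen -> Prop) :
  (forall a b, rel a b -> falg_eval a = falg_eval b) ->
  forall u, u \in rel_ideal rel -> falg_eval u = 0.
Proof.
move=> relf u /asboolP/(_ [pred v | falg_eval v == 0]) h; apply/eqP/h.
- split; first split; first by rewrite inE raddf0.
    by move=> v w; rewrite !inE => /eqP v0 /eqP w0; rewrite raddfB /= v0 w0 subrr.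
  move=> a v b; rewrite !inE => /eqP v0.
  by rewrite !rmorphM /= v0 mulr0 mul0r.
- by move=> a b /relf ab; rewrite inE raddfB /= ab subrr.
Qed.

Lemma falg_eval_proper (rel : falg k gen -> falg k gen -> Prop) :
  (forall a b, rel a b -> falg_eval a = falg_eval b) -> 1 \notin rel_ideal rel.
Proof.
move=> /falg_eval_ideal h; apply/negP => /h /eqP.
by rewrite rmorph1 oner_eq0.
Qed.

End FreeAlgebraEval.

(* [prel_proper] is there because a [nzRingType] needs 1 <> 0; for the two
   algebras below it is witnessed by the counit. *)
Record presentation (k : comNzRingType) := Presentation {
  pgen : choiceType;
  prel : falg k pgen -> falg k pgen -> Prop;
  prel_proper : 1 \notin rel_ideal prel }.

Section PresentedAlgebra.
Variables (k : comNzRingType) (P : presentation k).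

Definition palg := quotmod (rel_ideal (@prel k P)).
HB.instance Definition _ := GRing.Lmodule.on palg.

Local Notation pi := (@qproj k (falg k (pgen P)) (rel_ideal (@prel k P))).

Definition palg_one : palg := pi 1.
Definition palg_mul (p q : palg) : palg := pi (repr p * repr q).

Lemma palg_mulE u v : palg_mul (pi u) (pi v) = pi (u * v).
Proof.
apply/qprojP; set u' := repr (pi u); set v' := repr (pi v).
have Ju : u' - u \in rel_ideal (@prel k P) by apply/qprojP/qproj_repr.
have Jv : v' - v \in rel_ideal (@prel k P) by apply/qprojP/qproj_repr.
have -> : u' * v' - u * v = 1 * (u' - u) * v' + u * (v' - v) * 1.
  by rewrite mul1r mulr1 mulrBl mulrBr addrA subrK.
by rewrite rpredD //; exact: rel_ideal_mul.
Qed.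

Fact palg_mulA : associative palg_mul.
Proof.
move=> p q r; rewrite -[p]qproj_repr -[q]qproj_repr -[r]qproj_repr.
by rewrite !palg_mulE mulrA.
Qed.
Fact palg_mul1 : left_id palg_one palg_mul.
Proof. by move=> p; rewrite -[p]qproj_repr palg_mulE mul1r. Qed.
Fact palg_mulr1 : right_id palg_one palg_mul.
Proof. by move=> p; rewrite -[p]qproj_repr palg_mulE mulr1. Qed.
Fact palg_mulDl : left_distributive palg_mul +%R.
Proof.
move=> p q r; rewrite -[p]qproj_repr -[q]qproj_repr -[r]qproj_repr.
by rewrite -raddfD !palg_mulE mulrDl raddfD.
Qed.
Fact palg_mulDr : right_distributive palg_mul +%R.
Proof.
move=> p q r; rewrite -[p]qproj_repr -[q]qproj_repr -[r]qproj_repr.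
by rewrite -raddfD !palg_mulE mulrDr raddfD.
Qed.
Fact palg_one_neq0 : palg_one != 0.
Proof.
rewrite -(raddf0 pi); apply/eqP=> /qprojP; rewrite subr0.
exact/negP/prel_proper.
Qed.
HB.instance Definition _ := GRing.Zmodule_isNzRing.Build palg
  palg_mulA palg_mul1 palg_mulr1 palg_mulDl palg_mulDr palg_one_neq0.

Definition pclass (u : falg k (pgen P)) : palg := pi u.

Lemma pclass_repr p : pclass (repr p) = p.
Proof. exact: qproj_repr. Qed.

Fact pclass_zmod : zmod_morphism pclass.
Proof. exact: raddfB. Qed.
Fact pclass_monoid : monoid_morphism pclass.
Proof. by split=> [|u v]; [reflexivity | exact/esym/palg_mulE]. Qed.
Fact pclass_scale : scalable pclass.
Proof. exact: qproj_scale. Qed.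
HB.instance Definition _ := GRing.isZmodMorphism.Build _ _ pclass pclass_zmod.
HB.instance Definition _ := GRing.isMonoidMorphism.Build _ _ pclass pclass_monoid.

Fact palg_scalerAl (c : k) (p q : palg) : c *: (p * q) = (c *: p) * q.
Proof.
by rewrite -[p]pclass_repr -[q]pclass_repr -rmorphM -!pclass_scale -rmorphM scalerAl.
Qed.
HB.instance Definition _ := GRing.Lmodule_isLalgebra.Build k palg palg_scalerAl.

Fact palg_scalerAr (c : k) (p q : palg) : c *: (p * q) = p * (c *: q).
Proof.
by rewrite -[p]pclass_repr -[q]pclass_repr -rmorphM -!pclass_scale -rmorphM scalerAr.
Qed.
HB.instance Definition _ := GRing.Lalgebra_isAlgebra.Build k palg palg_scalerAr.

HB.instance Definition _ := GRing.isScalable.Build k _ _ *:%R pclass pclass_scale.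

Lemma pclass_rel u v : prel u v -> pclass u = pclass v.
Proof. by move=> uv; apply/qprojP/rel_idealP. Qed.

Section Lift.
Variables (A : algType k) (f : pgen P -> A).
Hypothesis frel : forall u v, prel u v -> falg_eval f u = falg_eval f v.

Definition palg_lift of (forall u v, prel u v -> falg_eval f u = falg_eval f v) :=
  fun p : palg => falg_eval f (repr p).

Lemma palg_liftE u : palg_lift frel (pclass u) = falg_eval f u.
Proof.
apply/eqP; rewrite -subr_eq0 -raddfB; apply/eqP/(falg_eval_ideal frel).
exact/qprojP/qproj_repr.
Qed.

Fact palg_lift_zmod : zmod_morphism (palg_lift frel).
Proof.
move=> p q; rewrite -[p]pclass_repr -[q]pclass_repr -raddfB !palg_liftE.
exact: raddfB.
Qed.
Fact palg_lift_monoid : monoid_morphism (palg_lift frel).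
Proof.
split=> [|p q]; first by rewrite -(rmorph1 pclass) palg_liftE rmorph1.
rewrite -[p]pclass_repr -[q]pclass_repr -rmorphM !palg_liftE.
exact: rmorphM.
Qed.
Fact palg_lift_scale : scalable (palg_lift frel).
Proof.
move=> c p; rewrite -[p]pclass_repr -linearZ /= !palg_liftE.
exact: linearZ.
Qed.
HB.instance Definition _ :=
  GRing.isZmodMorphism.Build _ _ (palg_lift frel) palg_lift_zmod.
HB.instance Definition _ :=
  GRing.isMonoidMorphism.Build _ _ (palg_lift frel) palg_lift_monoid.
HB.instance Definition _ :=
  GRing.isScalable.Build k _ _ *:%R (palg_lift frel) palg_lift_scale.

End Lift.
End PresentedAlgebra.

(* The group law of ['S_3] in the library composes permutations from left to
   right; [a ∘ b] is the composite "first b, then a". *)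
Definition compS (a b : 'S_3) : 'S_3 := (b * a)%g.
Notation "a ∘ b" := (compS a b) (at level 40, left associativity).

Definition is_transp (t : 'S_3) : bool :=
  [exists i : 'I_3, exists j : 'I_3, (i != j) && (t == tperm i j)].

Record transp := Transp { tval :> 'S_3; _ : is_transp tval }.
HB.instance Definition _ := [isSub for tval].
HB.instance Definition _ := [Finite of transp by <:].

Fact tr_subproof (i j : 'I_3) : i != j -> is_transp (tperm i j).
Proof. by move=> ij; apply/existsP; exists i; apply/existsP; exists j; rewrite ij /=. Qed.

Definition tr (i j : 'I_3) (ij : i != j) : transp := Transp (tr_subproof ij).

Fact conjt_subproof (a : 'S_3) (t : transp) : is_transp (a ∘ t ∘ a^-1%g).
Proof.
case: t => t /= /existsP[i /existsP[j /andP[ij /eqP->]]].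
rewrite [_ ∘ _](tpermJ i j a); apply: tr_subproof.
by rewrite (inj_eq perm_inj).
Qed.

Definition conjt (a : 'S_3) (t : transp) : transp :=
  Transp (conjt_subproof a t).

(* The points 1, 2, 3 are the elements 0, 1, 2 of ['I_3], so that [ctr 0],
   [ctr 1], [ctr 2] are the transpositions (12), (23), (13). *)
Fact ctr_subproof (i : 'I_3) : i != ordS i.
Proof. by case: i => [[|[|[|]]]]. Qed.

Definition ctr (i : 'I_3) : transp := tr (ctr_subproof i).

Lemma ctr_inj : injective ctr.
Proof.
move=> i j /(congr1 val)/= /permP h; apply/val_inj => /=.
have := h i; have := h j; rewrite !tpermL.
case: i j {h} => [[|[|[|]]]] //= ? [[|[|[|]]]] //= ?;
  rewrite /tperm !permE /= => /(congr1 val) /= ? /(congr1 val) //=.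
Qed.

Lemma ctr_surj t : exists i, ctr i = t.
Proof.
case: t => t Pt; case/existsP: (Pt) => i /existsP[j /andP[ij /eqP ?]]; subst t.
have E l : val (ctr l) = tperm i j -> exists i0, ctr i0 = Transp Pt.
  by move=> h; exists l; apply: val_inj.
have [/eqP e|ne] := boolP (j == ordS i); first by apply: (E i); rewrite /= e.
apply: (E j); rewrite /= tpermC; congr tperm; apply: val_inj; move: ij ne.
by case: i {E Pt} j => [[|[|[|]]]] //= ? [[|[|[|]]]].
Qed.

Section Relations.
Variables (A : nzRingType) (g d : 'S_3 -> A).

(* The constructors are the defining relations "left = right", the [g a] being
   the group elements and the [d a] the idempotents. *)
Inductive DS3_rel : A -> A -> Prop :=
| DS3_g1 : DS3_rel (g 1%g) 1
| DS3_gM a b : DS3_rel (g a * g b) (g (a ∘ b))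
| DS3_dM a b : DS3_rel (d a * d b) (if a == b then d a else 0)
| DS3_d1 : DS3_rel (\sum_a d a) 1
| DS3_dg h a : DS3_rel (d h * g a) (g a * d (a^-1%g ∘ h ∘ a)).

Inductive FK_rel (x : transp -> A) : A -> A -> Prop :=
| FK_sq t : FK_rel x (x t * x t) 0
| FK_tri i j k (ij : i != j) (ik : i != k) (jk : j != k) :
    FK_rel x (x (tr ij) * x (tr ik) + x (tr jk) * x (tr ij)
              + x (tr ik) * x (tr jk)) 0.

Variables x y : transp -> A.

(* [(-1) ^+ a] is the sign of the permutation [a]. *)
Inductive D_rel : A -> A -> Prop :=
| D_DS3 u v : DS3_rel u v -> D_rel u v
| D_FKx u v : FK_rel x u v -> D_rel u v
| D_FKy u v : FK_rel y u v -> D_rel u v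
| D_gx a t : D_rel (g a * x t) ((-1) ^+ a * x (conjt a t) * g a)
| D_dx h t : D_rel (d h * x t) (x t * d (t ∘ h))
| D_dy h t : D_rel (d h * y t) (y t * d (t ∘ h))
| D_yg t a : D_rel (y t * g a) ((-1) ^+ a * g a * y (conjt a^-1%g t))
| D_yx t : D_rel (y t * x t + x t * y t) (1 + g t * (d t - d 1%g))
| D_yx' i j k (ij : i != j) (ik : i != k) (jk : j != k) :
    D_rel (y (tr ik) * x (tr ij) + x (tr ij) * y (tr jk))
          (g (tr ij) * (d (tr ik) - d (tr ik ∘ tr ij))).

End Relations.

Lemma DS3_rel_map (A B : nzRingType) (f : {rmorphism A -> B})
    (g d : 'S_3 -> A) (g' d' : 'S_3 -> B) :
  (forall a, f (g a) = g' a) -> (forall a, f (d a) = d' a) ->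
  forall u v, DS3_rel g d u v -> DS3_rel g' d' (f u) (f v).
Proof.
move=> fg fd u v [|a b|a b||h a]; rewrite ?(rmorphM, rmorph1, rmorph_sum) /=.
- by rewrite fg; constructor.
- by rewrite !fg; constructor.
- by rewrite !fd (fun_if f) fd rmorph0; constructor.
- by rewrite (eq_bigr _ (fun i _ => fd i)); constructor.
- by rewrite !fg !fd; constructor.
Qed.

Lemma FK_rel_map (A B : nzRingType) (f : {rmorphism A -> B})
    (x : transp -> A) (x' : transp -> B) :
  (forall t, f (x t) = x' t) ->
  forall u v, FK_rel x u v -> FK_rel x' (f u) (f v).
Proof.
move=> fx u v [t|i j l ij il jl]; rewrite !(rmorphD, rmorphM, rmorph0) /= !fx;
  by constructor.
Qed.

Lemma D_rel_map (A B : nzRingType) (f : {rmorphism A -> B})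
    (g d : 'S_3 -> A) (x y : transp -> A)
    (g' d' : 'S_3 -> B) (x' y' : transp -> B) :
  (forall a, f (g a) = g' a) -> (forall a, f (d a) = d' a) ->
  (forall t, f (x t) = x' t) -> (forall t, f (y t) = y' t) ->
  forall u v, D_rel g d x y u v -> D_rel g' d' x' y' (f u) (f v).
Proof.
move=> fg fd fx fy u v; case=> {u v}.
- by move=> u v h; apply: D_DS3; apply: DS3_rel_map h.
- by move=> u v h; apply: D_FKx; apply: FK_rel_map h.
- by move=> u v h; apply: D_FKy; apply: FK_rel_map h.
- by move=> a t; rewrite !rmorphM rmorph_sign /= !fg !fx; constructor.
- by move=> h t; rewrite !rmorphM /= !fd !fx; constructor.
- by move=> h t; rewrite !rmorphM /= !fd !fy; constructor.
- by move=> t a; rewrite !rmorphM rmorph_sign /= !fg !fy; constructor.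
- move=> t; rewrite !(rmorphM, rmorphD, rmorphN, rmorph1) /= !fg !fd !fx !fy.
  by constructor.
- move=> i j l ij il jl; rewrite !(rmorphM, rmorphD, rmorphN) /= !fg !fd !fx !fy.
  by constructor.
Qed.

Lemma D_rel_lift (A B : nzRingType) (f : {rmorphism A -> B})
    (g d : 'S_3 -> A) (x y : transp -> A) u v :
  D_rel (f \o g) (f \o d) (f \o x) (f \o y) u v ->
  exists u' v', [/\ D_rel g d x y u' v', f u' = u & f v' = v].
Proof.
have FK z w t : FK_rel (f \o z) w t ->
    exists u' v', [/\ FK_rel z u' v', f u' = w & f v' = t].
  case=> [s|i j l ij il jl] /=; do 2![eexists]; split;
    [exact: FK_sq | by rewrite rmorphM | exact: rmorph0
    | exact: (FK_tri z ij il jl) | by rewrite !rmorphD !rmorphM | exact: rmorph0].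
case=> {u v} [u v []|u v /FK[u' [v' [h <- <-]]]|u v /FK[u' [v' [h <- <-]]]|||||
  |i j l ij il jl] /=.
- by exists (g 1%g), 1; rewrite rmorph1; split=> //; do 2!constructor.
- by move=> a b; exists (g a * g b), (g (a ∘ b)); rewrite rmorphM; split=> //; do 2!constructor.
- move=> a b; exists (d a * d b), (if a == b then d a else 0).
  by rewrite rmorphM (fun_if f) rmorph0; split=> //; do 2!constructor.
- by exists (\sum_a d a), 1; rewrite rmorph1 rmorph_sum; split=> //; do 2!constructor.
- move=> h a; exists (d h * g a), (g a * d (a^-1%g ∘ h ∘ a)).
  by rewrite !rmorphM; split=> //; do 2!constructor.
- by exists u', v'; split=> //; apply: D_FKx.
- by exists u', v'; split=> //; apply: D_FKy.
- by move=> a t; do 2![eexists]; split; [exact: D_gx | rewrite rmorphM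
    | rewrite !rmorphM rmorph_sign].
- by move=> h t; do 2![eexists]; split; [exact: D_dx | rewrite rmorphM
    | rewrite !rmorphM].
- by move=> h t; do 2![eexists]; split; [exact: D_dy | rewrite rmorphM
    | rewrite !rmorphM].
- by move=> t a; do 2![eexists]; split; [exact: D_yg | rewrite rmorphM
    | rewrite !rmorphM rmorph_sign].
- by move=> t; do 2![eexists]; split; [exact: D_yx | rewrite rmorphD !rmorphM
    | rewrite rmorphD rmorphM rmorphB rmorph1].
- by do 2![eexists]; split; [exact: (D_yx' g d x y ij il jl) | rewrite rmorphD !rmorphM
    | rewrite rmorphM rmorphB].
Qed.

Lemma DS3_counit (A : nzRingType) (u v : A) :
  DS3_rel (fun=> 1) (fun a => (a == 1%g)%:R) u v -> u = v.
Proof.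
case=> [|a b|a b||h a] //=; first by rewrite mulr1.
- rewrite -natrM mulnb; have [<-|ab] := eqVneq a b; first by rewrite andbb.
  by case: (a =P 1%g) ab => // ->; rewrite eq_sym => /negPf->.
- by rewrite (bigD1 1%g) //= eqxx big1 ?addr0 // => i /negPf->.
- rewrite mulr1 mul1r /compS; congr (_%:R); congr nat_of_bool.
  by rewrite -{1}[a]invgK -conjgE conjg_eq1.
Qed.

Section Algebras.
Variable k : fieldType.

Inductive DS3_gen := DS3_G of 'S_3 | DS3_D of 'S_3.

Definition DS3_code (s : DS3_gen) : 'S_3 + 'S_3 :=
  match s with DS3_G a => inl a | DS3_D a => inr a end.
Definition DS3_decode (s : 'S_3 + 'S_3) : DS3_gen :=
  match s with inl a => DS3_G a | inr a => DS3_D a end.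
Fact DS3_codeK : cancel DS3_code DS3_decode. Proof. by case. Qed.
HB.instance Definition _ := Countable.copy DS3_gen (can_type DS3_codeK).

Definition DS3_gen_rel : falg k DS3_gen -> falg k DS3_gen -> Prop :=
  DS3_rel (fun a => letter k (DS3_G a)) (fun a => letter k (DS3_D a)).

Section DS3Lift.
Variables (A : algType k) (g d : 'S_3 -> A).

Definition DS3_fun (s : DS3_gen) : A :=
  match s with DS3_G a => g a | DS3_D a => d a end.

Lemma DS3_fun_rel : (forall u v, DS3_rel g d u v -> u = v) ->
  forall u v, DS3_gen_rel u v -> falg_eval DS3_fun u = falg_eval DS3_fun v.
Proof.
move=> H u v /(@DS3_rel_map _ _ (falg_eval DS3_fun) _ _ g d) h.
by apply/H/h => a; apply: falg_eval_letter.
Qed.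

End DS3Lift.

Definition DS3_pres : presentation k :=
  Presentation (falg_eval_proper (DS3_fun_rel (@DS3_counit k^o))).

Definition DS3 := palg DS3_pres.
HB.instance Definition _ := GRing.Algebra.on DS3.

Definition DS3_lift (A : algType k) (g d : 'S_3 -> A)
    (H : forall u v, DS3_rel g d u v -> u = v) : DS3 -> A :=
  @palg_lift k DS3_pres A (DS3_fun g d) (DS3_fun_rel H).
HB.instance Definition _ (A : algType k) (g d : 'S_3 -> A) H :=
  GRing.LRMorphism.on (@DS3_lift A g d H).

Inductive D_gen := D_X of transp | D_Y of transp | D_G of 'S_3 | D_D of 'S_3.

Definition D_code (s : D_gen) : (transp + transp) + ('S_3 + 'S_3) :=
  match s with
  | D_X t => inl (inl t) | D_Y t => inl (inr t)
  | D_G a => inr (inl a) | D_D a => inr (inr a)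
  end.
Definition D_decode (s : (transp + transp) + ('S_3 + 'S_3)) : D_gen :=
  match s with
  | inl (inl t) => D_X t | inl (inr t) => D_Y t
  | inr (inl a) => D_G a | inr (inr a) => D_D a
  end.
Fact D_codeK : cancel D_code D_decode. Proof. by case. Qed.
HB.instance Definition _ := Countable.copy D_gen (can_type D_codeK).

Definition D_gen_rel : falg k D_gen -> falg k D_gen -> Prop :=
  D_rel (fun a => letter k (D_G a)) (fun a => letter k (D_D a))
        (fun t => letter k (D_X t)) (fun t => letter k (D_Y t)).

Section DLift.
Variables (A : algType k) (g d : 'S_3 -> A) (x y : transp -> A).

Definition D_fun (s : D_gen) : A :=
  match s with D_X t => x t | D_Y t => y t | D_G a => g a | D_D a => d a end.

Lemma D_fun_rel : (forall u v, D_rel g d x y u v -> u = v) ->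
  forall u v, D_gen_rel u v -> falg_eval D_fun u = falg_eval D_fun v.
Proof.
move=> H u v /(@D_rel_map _ _ (falg_eval D_fun) _ _ _ _ g d x y) h.
by apply/H/h => a; apply: falg_eval_letter.
Qed.

End DLift.

Fact D_counit u v :
  D_rel (fun=> 1 : k^o) (fun a => (a == 1%g)%:R) (fun=> 0) (fun=> 0) u v -> u = v.
Proof.
have N1 (t : transp) : (tval t == 1%g) = false.
  case: t => t /= /existsP[i /existsP[j /andP[ij /eqP->]]].
  by apply/negP=> /eqP/permP/(_ i); rewrite tpermL perm1 => /eqP; rewrite eq_sym (negPf ij).
case=> {u v}; try by move=> *; rewrite !(mulr0, mul0r).
- exact: DS3_counit.
- by move=> u v [t|*]; rewrite !mulr0 ?addr0.
- by move=> u v [t|*]; rewrite !mulr0 ?addr0.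
- by move=> t; rewrite N1 eqxx !(mulr0, add0r, mul1r) subrr.
- move=> i j l ij il jl; rewrite N1 /compS -[_ == 1%g]/(_ == 1%g).
  have -> : (tval (tr ij) * tval (tr il))%g == 1%g = false.
    apply/negP=> /eqP/permP/(_ i); rewrite permM perm1 /= tpermL tpermD ?[l == j]eq_sym //.
    by move/eqP; rewrite eq_sym (negPf ij).
  by rewrite !(mulr0, mul0r, addr0, subr0).
Qed.

Definition D_pres : presentation k := Presentation (falg_eval_proper (D_fun_rel D_counit)).

Definition D := palg D_pres.
HB.instance Definition _ := GRing.Algebra.on D.

Definition DS3_g (a : 'S_3) : DS3 := @pclass k DS3_pres (letter k (DS3_G a)).
Definition DS3_d (a : 'S_3) : DS3 := @pclass k DS3_pres (letter k (DS3_D a)).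

Definition D_g (a : 'S_3) : D := @pclass k D_pres (letter k (D_G a)).
Definition D_d (a : 'S_3) : D := @pclass k D_pres (letter k (D_D a)).
Definition D_x (t : transp) : D := @pclass k D_pres (letter k (D_X t)).
Definition D_y (t : transp) : D := @pclass k D_pres (letter k (D_Y t)).

Lemma D_relP u v : D_rel D_g D_d D_x D_y u v -> u = v.
Proof.
by case/(@D_rel_lift _ _ (@pclass k D_pres)) => u' [v' [h <- <-]]; apply: pclass_rel.
Qed.

Fact D_DS3_rel u v : DS3_rel D_g D_d u v -> u = v.
Proof. by move=> h; apply: D_relP; apply: D_DS3. Qed.

Definition DS3_to_D : DS3 -> D := DS3_lift D_DS3_rel.
HB.instance Definition _ := GRing.LRMorphism.on DS3_to_D.

Definition ep_g (a : 'S_3) : 'M[k]_1 := 1.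
Definition ep_d (a : 'S_3) : 'M[k]_1 := (a == 1%g)%:R.

Fact ep_rel u v : DS3_rel ep_g ep_d u v -> u = v.
Proof.
exact: DS3_counit.
Qed.

Definition M_e_plus : lmodType DS3 := colmod (DS3_lift ep_rel).

(* Column [j] is the image of the basis vector indexed by [ctr j]. *)
Definition sm_g (a : 'S_3) : 'M[k]_3 :=
  \matrix_(i, j) ((-1) ^+ a *+ (ctr i == conjt a (ctr j))).
Definition sm_d (a : 'S_3) : 'M[k]_3 :=
  \matrix_(i, j) ((i == j) && (a == ctr i))%:R.

Fact sm_rel u v : DS3_rel sm_g sm_d u v -> u = v.
Proof.
have E1 : conjt 1%g =1 id.
  by move=> t; apply: val_inj; rewrite /= /compS invg1 mul1g mulg1.
have EM a b t : conjt a (conjt b t) = conjt (a ∘ b) t.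
  by apply: val_inj; rewrite /= /compS invMg !mulgA.
case=> {u v} [|a b|a b||h a]; apply/matrixP=> i j.
- by rewrite !mxE odd_perm1 E1 (inj_eq ctr_inj) expr0.
- have [l El] := ctr_surj (conjt b (ctr j)).
  rewrite !mxE (bigD1 l) //= !mxE El eqxx EM big1 => [|m ml].
    by rewrite addr0 mulr1n mulrnAl odd_permM signr_addb mulrC.
  by rewrite !mxE -El (inj_eq ctr_inj) (negPf ml) mulr0.
- rewrite !mxE (bigD1 i) //= big1 => [|m mi]; last first.
    by rewrite !mxE [i == m]eq_sym (negPf mi) mul0r.
  rewrite !mxE eqxx addr0 /=; have [<-|ab] := eqVneq a b.
    by rewrite mxE; case: (i == j); case: (a == _); rewrite ?(mulr0, mulr1).
  rewrite mxE -natrM mulnb; case: (a =P tval (ctr i)) ab => [->|_ _].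
    by rewrite eq_sym => /negPf->; rewrite !andbF.
  by rewrite ?(andbF, andFb).
- rewrite summxE (bigD1 (tval (ctr i))) //= !mxE eqxx andbT big1 ?addr0 // => h hi.
  by rewrite !mxE (negPf hi) andbF.
- rewrite !mxE (bigD1 i) //= [RHS](bigD1 j) //= !mxE !eqxx /=.
  rewrite !big1 ?addr0 => [|m mj|m mi].
  + case: (ctr i =P _) => [e|_]; last by rewrite mulr0n mulr0 mul0r.
    rewrite -[tperm i _]/(tval (ctr i)) e mulr1n mulr_natl mulr_natr; congr (_ *+ nat_of_bool _).
    rewrite -[tval (conjt _ _)]/(a ∘ tperm j (ordS j) ∘ a^-1%g) /compS.
    by apply/eqP/eqP => [->|<-]; rewrite !mulgA ?(mulgV, mulgK, mulgKV, mul1g, mulVg).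
  + by rewrite !mxE (negPf mj) mulr0.
  + by rewrite !mxE [i == m]eq_sym (negPf mi) mul0r.
Qed.

Definition M_sigma_minus : lmodType DS3 := colmod (DS3_lift sm_rel).

Definition ket (i : 'I_3) : M_sigma_minus := delta_mx i 0 : 'cV[k]_3.

Section Verma.
Variable N : lmodType DS3.

(* The subalgebra of D generated by D(S_3) and the [D_y t] is the set of all [b]
   with [Dge0_acts b p] for some [p], and [p] is then the action of [b] on [N]
   for which N is inflated: D(S_3) acts as given and the [D_y t] act by 0. *)
Inductive Dge0_acts : D -> (N -> N) -> Prop :=
| acts_DS3 b : Dge0_acts (DS3_to_D b) (fun n => b *: n)
| acts_y t : Dge0_acts (D_y t) (fun=> 0)
| acts_add b c p q : Dge0_acts b p -> Dge0_acts c q ->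
    Dge0_acts (b + c) (fun n => p n + q n)
| acts_mul b c p q : Dge0_acts b p -> Dge0_acts c q ->
    Dge0_acts (b * c) (fun n => p (q n)).

(* [<< a *g n >>] is the generator "a tensor n" of the free module on N;
   additivity in [a] holds already in that free module. *)
Inductive tensor_rel : {malg D[N]} -> Prop :=
| tensor_add a n n' :
    tensor_rel (<< a *g (n + n')%R >> - << a *g n >> - << a *g n' >>)
| tensor_bal a b p n : Dge0_acts b p ->
    tensor_rel (<< a * b *g n >> - << a *g p n >>).

Definition verma := quotmod (gen_submod tensor_rel).
HB.instance Definition _ := GRing.Lmodule.on verma.

Definition tens (a : D) (n : N) : verma := qproj (gen_submod tensor_rel) << a *g n >>.

End Verma.

Definition highest_weight (V : lmodType D) (W : lmodType DS3) : Prop :=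
  exists M : submodule (restr DS3_to_D V),
    [/\ mod_isom (submod M) W,
        forall t m, m \in M -> D_y t *: (m : V) = 0 &
        forall v : V, v \in gen_submod (fun m : V => m \in M)].

(* The vector |e>^1. *)
Definition e_one : verma M_sigma_minus := \sum_i tens (D_x (ctr i)) (ket i).

(* T is the direct sum of the line spanned over k by |e>^1 and of the socle. *)
Definition is_T10 (T : submodule (verma M_sigma_minus)) : Prop :=
  e_one \notin socle (verma M_sigma_minus) /\
  forall v, v \in T <->
    exists (a : k) (s : verma M_sigma_minus),
      s \in socle (verma M_sigma_minus) /\ v = a%:A *: e_one + s.

End Algebras.

(* Main.v *)
(* A Verma module is B(V) (x) N, and B(V) is a Frobenius algebra of dimension 12
   concentrated in degrees 0 to 4. Hence every nonzero submodule contains a nonzero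
   vector of the top degree part w (x) N, where w spans B^4(V), and the socle is
   generated by w (x) N.

   In M(e,+) all y_t x_s |e> vanish, so the terms of positive degree form a submodule.
   As the x_t generate a nilpotent ideal of B(V), a submodule containing an element
   with nonzero degree 0 term is everything, so this submodule is the radical. The
   head is thus a line on which D acts by the counit, and so is the socle k w|e>.

   In M(sigma,-) the vector |e>^1 is killed by the y_t and fixed by S_3, and each
   x_t |e>^1 equals some y_u y_v w|ij>, which lies in the socle; thus D acts on the
   class of |e>^1 modulo the socle by the counit. If |e>^1 were in the socle, it would
   lie in the image of the radical under M(e,+) -> M(sigma,-), |e> |-> |e>^1, so the
   kernel of this map would contain an element with nonzero degree 0 term and the map
   would vanish, although it sends a suitable cubic word to a nonzero w|ij>.

   That w (x) N is nonzero, and the identities involving the y_t, are read off matrix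
   representations of D of dimensions 12 and 36, whose relations are checked by
   computation. *)
Require Import Defs.
From HB Require Import structures.
From mathcomp Require Import all_boot all_order all_fingroup all_algebra.
From mathcomp Require Import boolp finmap generic_quotient ring_quotient.
From mathcomp.multinomials Require Import monalg.

Set Implicit Arguments.
Unset Strict Implicit.
Unset Printing Implicit Defensive.

Import GRing.Theory.
Local Open Scope ring_scope.

(** * Modules and presented algebras *)

Section ModuleTheory.
Variable R : nzRingType.
Implicit Types U V W : lmodType R.

Lemma bijective_inj_surj (A B : Type) (f : A -> B) :
  injective f -> (forall b, exists a, f a = b) -> bijective f.
Proof.
move=> injf surjf; exists (fun b => projT1 (cid (surjf b))) => [a|b].
  by apply: injf; case: cid.
by case: cid.
Qed.

Lemma mod_isom_inj_surj U V (f : {linear U -> V}) :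
  (forall u, f u = 0 -> u = 0) -> (forall v, exists u, f u = v) -> mod_isom U V.
Proof.
move=> injf surjf; exists f; apply: bijective_inj_surj surjf => u v fuv.
by apply: subr0_eq; apply: injf; rewrite linearB fuv subrr.
Qed.

Lemma mod_isom_sym U V : mod_isom U V -> mod_isom V U.
Proof.
move=> [f [g fK gK]].
have lin_g : linear g by apply: can2_linear fK gK.
pose G : {linear V -> U} := HB.pack g (GRing.isLinear.Build R V U *:%R g lin_g).
by exists G, f.
Qed.

Lemma mod_isom_trans U V W : mod_isom U V -> mod_isom V W -> mod_isom U W.
Proof. by move=> [f bf] [g bg]; exists (g \o f); apply: bij_comp. Qed.

(** A simple submodule contains [S] and meets it nontrivially, hence lies inside [S]. Conversely [S]
    is simple because the image in [V] of any nonzero submodule of [submod S] again contains [S]. *)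
Lemma socle_minimal V (S : submodule V) v0 : v0 \in S -> v0 != 0 ->
    (forall (U : submodule V) u, u \in U -> u != 0 -> {subset S <= U}) ->
  socle V =i S.
Proof.
move=> Sv0 v0N0 minS.
have subpreP (U' : submodule V) : is_simple (submod U') -> {subset U' <= S}.
  move=> [[[u Uu] uN0] simU].
  have SU : {subset S <= U'} by apply: (minS U' u) => //; apply: contraNneq uN0 => u0; apply/eqP/val_inj.
  have [z|full w Uw] := simU (subpre U' S).
    by have /(congr1 val)/= /eqP := z (Sub v0 (SU _ Sv0)) Sv0; rewrite (negPf v0N0).
  exact: (full (Sub w Uw)).
move=> v; apply/asboolP/idP => [|Sv U]; first by apply=> u [U /subpreP]; apply.
apply; exists S => //; split; first by exists (Sub v0 Sv0); apply: contraNneq v0N0 => /(congr1 val)/= ->.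
move=> U'.
have imP : submod_closed [pred x : V | `[< exists2 y : submod S, y \in U' & val y = x >]].
  split=> [|a x y /asboolP[x' Ux <-] /asboolP[y' Uy <-]]; apply/asboolP.
    by exists 0; [apply: rpred0|].
  by exists (a *: x' + y') => //; apply: (submod_predP U').2.
have [[y Uy yN0]|none] := pselect (exists2 y : submod S, y \in U' & y != 0).
  right=> x; have /asboolP[x' Ux' /val_inj<-] // : val x \in Submodule imP.
  apply: (minS _ (val y)); last exact: valP.
    by apply/asboolP; exists y.
  by apply: contraNneq yN0 => y0; apply/eqP/val_inj.
by left=> x Ux; apply/eqP; apply: contra_notT none => xN0; exists x.
Qed.

Fact ker_submodP U V (f : {linear U -> V}) : submod_closed [pred u : U | f u == 0].
Proof.
split=> [|a u v]; first by rewrite inE linear0.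
by rewrite !inE => /eqP fu /eqP fv; rewrite linearP fu fv scaler0 addr0.
Qed.

Definition ker_submod U V (f : {linear U -> V}) : submodule U := Submodule (ker_submodP f).

Lemma mem_ker_submod U V (f : {linear U -> V}) u : (u \in ker_submod f) = (f u == 0).
Proof. by []. Qed.

Lemma full_submod_isom V (M : submodule V) :
  (forall v, v \in M) -> mod_isom (submod M) V.
Proof.
move=> fullM; have lin_val : linear (val : submod M -> V) by [].
pose f : {linear submod M -> V} :=
  HB.pack (val : submod M -> V) (GRing.isLinear.Build R _ _ _ _ lin_val).
apply: (@mod_isom_inj_surj _ _ f) => [u u0|v]; first exact/val_inj.
by exists (Sub v (fullM v)).
Qed.

End ModuleTheory.

Lemma palg_ind (k : comNzRingType) (P : presentation k) (Q : palg P -> Prop) :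
    (forall a b, Q a -> Q b -> Q (a + b)) -> (forall a b, Q a -> Q b -> Q (a * b)) ->
    (forall c, Q c%:A) -> (forall i, Q (pclass (letter k i))) ->
  forall a, Q a.
Proof.
move=> QD QM Qc Ql a; rewrite -[a]pclass_repr; move: (repr a) => {a} u.
rewrite (monalgE u) rmorph_sum; elim/big_ind: _ => //=.
  (* The empty sum is treated as the scalar [0%:A]. *)
  by rewrite -(scale0r 1).
move=> m _; have -> : << u@_m *g m >> = u@_m *: (<< m >> : falg k (pgen P)).
  by apply/malgP => m'; rewrite mcoeffZ !mcoeffU mulr_natr.
rewrite linearZ /= -mulr_algl; apply: (QM) => //; rewrite -[m]fmK.
elim: (m : seq _) => [|i s IH].
  have -> : FMonom [::] = mone :> {fmonom pgen P} by rewrite -[mone]fmK fm1.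
  by rewrite -/(1 : falg k (pgen P)) rmorph1 -(scale1r 1).
have -> : << FMonom (i :: s) >> = letter k i * << FMonom s >> :> falg k (pgen P).
  rewrite /letter malgM_def fgmulUU mulr1; congr << _ >>.
  by rewrite -[RHS]fmK fmM fmU.
by rewrite rmorphM; apply: QM (Ql i) IH.
Qed.

(** * Verma modules *)

Lemma quotmod_lift (R : nzRingType) (V W : lmodType R) (U : submodule V)
    (F : {linear V -> W}) : {in U, forall v, F v = 0} ->
  exists f : {linear quotmod U -> W}, forall v, f (qproj U v) = F v.
Proof.
move=> F0; pose f (q : quotmod U) := F (generic_quotient.repr q).
have fE v : f (qproj U v) = F v.
  apply/eqP; rewrite -subr_eq0 -linearB F0 //; apply/qprojP; exact: qproj_repr.
have lin_f : linear f.
  move=> a p q; rewrite -[p]qproj_repr -[q]qproj_repr -linearP !fE.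
  exact: linearP.
by exists (HB.pack f (GRing.isLinear.Build R _ _ _ f lin_f) : {linear _ -> _}).
Qed.

Section VermaModule.
Variables (k : fieldType) (N : lmodType (DS3 k)).
Implicit Types (a b : D k) (n : N).

Lemma tensDr a n n' : tens a (n + n') = tens a n + tens a n'.
Proof.
apply/eqP; rewrite -subr_eq0 opprD addrA; apply/eqP.
rewrite /tens -!raddfB -(raddf0 (qproj _)); apply/qprojP; rewrite subr0.
by apply/asboolP => U; apply; apply: tensor_add.
Qed.

(** Compatibility with subtraction is extracted from additivity through
    [f (n - n') = (f (n - n') + f n') - f n']. *)
HB.instance Definition _ a := GRing.isZmodMorphism.Build N (verma N) (tens a)
  (fun n n' => etrans (esym (addrK _ _)) (congr1 (fun z => z - _)
    (etrans (esym (tensDr a _ _)) (congr1 (tens a) (subrK _ _))))).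

Lemma tens_bal a b p n : Dge0_acts b p -> tens (a * b) n = tens a (p n).
Proof.
by move=> bp; apply/qprojP/asboolP => U; apply; apply: tensor_bal.
Qed.

Lemma tensZ a b n : a *: tens b n = tens (a * b) n.
Proof.
rewrite /tens -linearZ; congr (qproj _ _); apply/malgP => n'.
by rewrite mcoeffZ !mcoeffU; case: eqP; rewrite ?mulr0.
Qed.

Lemma tensE a n : tens a n = a *: tens 1 n.
Proof. by rewrite tensZ mulr1. Qed.

Lemma DS3_tens (b : DS3 k) n : DS3_to_D b *: tens 1 n = tens 1 (b *: n).
Proof. by rewrite -(tens_bal 1 n (acts_DS3 N b)) tensZ mulr1 mul1r. Qed.

Lemma y_tens t n : D_y k t *: tens 1 n = 0.
Proof. by have := tens_bal 1 n (acts_y N t); rewrite raddf0 mul1r tensZ mulr1. Qed.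

Lemma verma_ind (P : verma N -> Prop) :
    (forall u v, P u -> P v -> P (u + v)) -> (forall a n, P (tens a n)) ->
  forall v, P v.
Proof.
move=> PD Pt v; rewrite -[v]qproj_repr (monalgE (generic_quotient.repr v)) raddf_sum.
elim/big_ind: _ => [||n _]; [|exact: PD|exact: Pt].
by rewrite -(raddf0 (tens 1)); apply: Pt.
Qed.

(** Frobenius reciprocity for the induced module. The map [j] is extended linearly to the free
    module; the generators of [tensor_rel] go to 0 since the prescribed action on [N] agrees with
    the action on the image of [j]. *)
Lemma verma_lift (W : lmodType (D k)) (j : N -> W) :
    (forall n n', j (n + n') = j n + j n') ->
    (forall (b : DS3 k) n, j (b *: n) = DS3_to_D b *: j n) ->
    (forall t n, D_y k t *: j n = 0) ->
  exists f : {linear verma N -> W}, forall a n, f (tens a n) = a *: j n.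
Proof.
move=> jD jZ jy.
pose ext (g : {malg (D k)[N]}) := \sum_(n <- msupp g) g@_n *: j n.
have extE (d : {fset N}) g : (msupp g `<=` d)%fset -> ext g = \sum_(n <- d) g@_n *: j n.
  move=> le; rewrite /ext (big_fset_incl _ le) // => n _ /mcoeff_outdom->.
  exact: scale0r.
have extU a n : ext << a *g n >> = a *: j n.
  by rewrite (extE _ _ msuppU_le) big_seq_fset1 mcoeffUU.
have lin_ext : linear ext.
  move=> a g h; rewrite (extE (msupp g `|` msupp h)%fset); last first.
    apply: (fsubset_trans (msuppD_le _ _)); apply: fsetSU; exact: msuppZ_le.
  rewrite [ext g](extE (msupp g `|` msupp h)%fset) ?fsubsetUl //.
  rewrite [ext h](extE (msupp g `|` msupp h)%fset) ?fsubsetUr //.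
  rewrite scaler_sumr -big_split; apply: eq_bigr => n _ /=.
  by rewrite mcoeffD mcoeffZ scalerDl scalerA.
pose F : {linear {malg (D k)[N]} -> W} :=
  HB.pack ext (GRing.isLinear.Build _ _ _ _ ext lin_ext).
(* The agreement is proved along the derivation of [Dge0_acts]; for a generator [y] it needs
   [j 0 = 0], which follows from additivity. *)
have actsE b p n : Dge0_acts b p -> b *: j n = j (p n).
  move=> bp; elim: bp n => {b p} [b|t|b c p q _ IHb _ IHc|b c p q _ IHb _ IHc] n.
  - by rewrite jZ.
  - by rewrite jy; apply: (addrI (j 0)); rewrite -jD !addr0.
  - by rewrite scalerDl IHb IHc jD.
  - by rewrite -scalerA IHc IHb.
have F0 : {in gen_submod (tensor_rel (N := N)), forall g, F g = 0}.
  move=> g /asboolP/(_ (ker_submod F)) h; apply/eqP/h => {h} {}g [a n n'|a b p n bp].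
    by rewrite mem_ker_submod !linearB /= !extU jD scalerDr addrAC addrK subrr.
  by rewrite mem_ker_submod linearB /= !extU -scalerA (actsE _ _ _ bp) subrr.
have [f fE] := quotmod_lift F0.
by exists f => a n; rewrite /tens fE /= extU.
Qed.

End VermaModule.

(** * The Fomin-Kirillov algebra *)

(* Formal integer combinations of basis vectors indexed by [nat], and linear
   maps between them given by the images of the basis vectors. *)
Definition svec : Type := seq (nat * int).

Definition sv_coef (v : svec) (i : nat) : int :=
  foldr (fun p c => if p.1 == i then p.2 + c else c) 0 v.

(** Equality as formal combinations: repeated indices add up, and an index occurring in neither list
    has coefficient 0 on both sides, so it suffices to test those of [v ++ w]. *)
Definition sv_eqb (v w : svec) : bool :=
  all (fun p => sv_coef v p.1 == sv_coef w p.1) (v ++ w).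

Definition sv_scale (c : int) (v : svec) : svec := [seq (p.1, c * p.2) | p <- v].

Definition sv_lin (f : nat -> svec) (v : svec) : svec :=
  flatten [seq sv_scale p.2 (f p.1) | p <- v].

Section SparseVectors.
Variable V : zmodType.
Implicit Types (e : nat -> V) (v w : svec).

Definition sv_eval e v : V := \sum_(p <- v) e p.1 *~ p.2.

Lemma sv_eval_nil e : sv_eval e [::] = 0.
Proof. exact: big_nil. Qed.

Lemma sv_eval1 e i : sv_eval e [:: (i, 1)] = e i.
Proof. by rewrite /sv_eval big_seq1 mulr1z. Qed.

Lemma sv_eval_cat e v w : sv_eval e (v ++ w) = sv_eval e v + sv_eval e w.
Proof. exact: big_cat. Qed.

Lemma sv_eval_scale e c v : sv_eval e (sv_scale c v) = sv_eval e v *~ c.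
Proof.
by rewrite /sv_eval big_map mulrz_suml; apply: eq_bigr => p _; rewrite /= mulrC mulrzA.
Qed.

Lemma sv_eval_lin e f v : sv_eval e (sv_lin f v) = sv_eval (sv_eval e \o f) v.
Proof.
elim: v => [|p v IH]; first by rewrite !sv_eval_nil.
rewrite [sv_lin _ _]/(_ ++ sv_lin f v) sv_eval_cat IH sv_eval_scale.
by rewrite [RHS]/sv_eval big_cons.
Qed.

Lemma eq_sv_eval e e' v : e =1 e' -> sv_eval e v = sv_eval e' v.
Proof. by move=> ee'; apply: eq_bigr => p _; rewrite ee'. Qed.

Lemma sv_eval_coef e v M : all (fun p => p.1 < M)%N v ->
  sv_eval e v = \sum_(i < M) e i *~ sv_coef v i.
Proof.
elim: v => [|[i c] v IH] /=; first by rewrite sv_eval_nil big1 // => i; rewrite mulr0z.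
case/andP=> iM vM; rewrite /sv_eval big_cons -/(sv_eval e v) IH //=.
rewrite (bigD1 (Ordinal iM)) //= [RHS](bigD1 (Ordinal iM)) //= eqxx mulrzDr addrA.
by congr (_ + _); apply: eq_bigr => j; rewrite -val_eqE /= eq_sym => /negPf->.
Qed.

Lemma sv_eqbP e v w : sv_eqb v w -> sv_eval e v = sv_eval e w.
Proof.
move=> vw; have outE u i : i \notin [seq p.1 | p <- u] -> sv_coef u i = 0.
  by elim: u => //= p u IH; rewrite inE negb_or eq_sym => /andP[/negPf-> /IH].
pose M := (\max_(p <- v ++ w) p.1).+1.
have ltM p : p \in v ++ w -> (p.1 < M)%N by move=> vp; rewrite ltnS; exact: (@leq_bigmax_seq _ _ _ fst).
rewrite !(@sv_eval_coef e _ M); last first.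
- by apply/allP=> p vp; apply: ltM; rewrite mem_cat vp.
- by apply/allP=> p vp; apply: ltM; rewrite mem_cat vp orbT.
apply: eq_bigr => i _; congr (_ *~ _).
have [/mapP[p vp ->]|] := boolP (val i \in [seq p.1 | p <- v ++ w]).
  exact/eqP/(allP vw).
by rewrite map_cat mem_cat negb_or => /andP[/outE-> /outE->].
Qed.

End SparseVectors.

(* A basis of the Fomin-Kirillov algebra, ordered by degree. The generators x_0, x_1,
   x_2 are x_(12), x_(23), x_(13), and a word is multiplied from left to right. *)
Definition fk_words : seq (seq nat) :=
  [:: [::]; [:: 0]; [:: 1]; [:: 2]; [:: 0; 1]; [:: 1; 0]; [:: 2; 0]; [:: 0; 2];
      [:: 0; 1; 0]; [:: 0; 2; 0]; [:: 1; 0; 2]; [:: 0; 1; 0; 2]]%N.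

Definition fk_word (i : nat) : seq nat := nth [::] fk_words i.

Lemma mulr_sv_eval (R : nzRingType) (a : R) (e : nat -> R) v :
  a * sv_eval e v = sv_eval (fun i => a * e i) v.
Proof. by rewrite /sv_eval mulr_sumr; apply: eq_bigr => p _; rewrite mulrzAr. Qed.

(* Entry [i] of list [s] is the expansion of [x_s * w_i] in the basis of words. *)
Definition fk_table : seq (seq svec) :=
  [:: [:: [:: (1, 1%Z)]; [::]; [:: (4, 1%Z)]; [:: (7, 1%Z)];
          [::]; [:: (8, 1%Z)]; [:: (9, 1%Z)]; [::]; [::]; [::]; [:: (11, 1%Z)]; [::]];
      [:: [:: (2, 1%Z)]; [:: (5, 1%Z)]; [::]; [:: (4, (-1)%Z); (6, (-1)%Z)];
          [:: (8, 1%Z)]; [::]; [:: (8, (-1)%Z)]; [:: (10, 1%Z)];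
          [::]; [:: (11, (-1)%Z)]; [::]; [::]];
      [:: [:: (3, 1%Z)]; [:: (6, 1%Z)]; [:: (7, (-1)%Z); (5, (-1)%Z)]; [::];
          [:: (10, 1%Z)]; [:: (9, (-1)%Z)]; [::]; [:: (9, 1%Z)];
          [:: (11, (-1)%Z)]; [::]; [::]; [::]]]%N.

Definition fk_mul (s i : nat) : svec := nth [::] (nth [::] fk_table s) i.

Section FominKirillov.
Variables (R : nzRingType) (x : nat -> R).

(** The cutoff at 12 is needed because [fk_word] defaults to the empty word, whose product would be
    1 rather than 0. *)
Definition fk_eval (i : nat) : R := (\prod_(s <- fk_word i) x s) *+ (i < 12)%N.

Hypothesis sq : forall s, (s < 3)%N -> x s * x s = 0.
Hypothesis rel1 : x 0 * x 1 + x 1 * x 2 + x 2 * x 0 = 0.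
Hypothesis rel2 : x 0 * x 2 + x 2 * x 1 + x 1 * x 0 = 0.

(** Every product of a letter and a basis word is rewritten into basis words by consequences of the
    quadratic relations in degrees 2, 3 and 4. *)
Lemma fk_mulE s i : (s < 3)%N ->
  x s * fk_eval i = sv_eval fk_eval (fk_mul s i).
Proof.
have aa := sq (isT : 0 < 3)%N; have bb := sq (isT : 1 < 3)%N; have cc := sq (isT : 2 < 3)%N.
have [r1 r2] := (rel1, rel2).
set a := x 0 in r1 r2 aa *; set b := x 1 in r1 r2 bb *; set c := x 2 in r1 r2 cc *.
(* Among products of two distinct letters, [b * c] and [c * b] are the only ones outside the
   basis. *)
have bc : b * c = - (a * b) - c * a by apply/eqP; rewrite -opprD -addr_eq0 addrCA addrA r1.
have cb : c * b = - (a * c) - b * a by apply/eqP; rewrite -opprD -addr_eq0 addrCA addrA r2.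
have bca : b * c * a = - (a * b * a) by rewrite bc mulrBl mulNr -(mulrA c) aa mulr0 subr0.
have cba : c * b * a = - (a * c * a) by rewrite cb mulrBl mulNr -(mulrA b) aa mulr0 subr0.
(* Multiplying the quadratic relations on the left by a letter gives the cubic ones, starting with
   the braid relations. *)
have bab : b * a * b = a * b * a.
  have := congr1 (fun z => b * z) r1; rewrite mulr0 !mulrDr !mulrA bb mul0r addr0 bca.
  exact: subr0_eq.
have cac : c * a * c = a * c * a.
  have := congr1 (fun z => c * z) r2; rewrite mulr0 !mulrDr !mulrA cc mul0r addr0 cba.
  exact: subr0_eq.
have cab : c * a * b = b * a * c.
  have bcb : b * c * b = - (c * a * b).
    by rewrite bc mulrBl mulNr -(mulrA a) bb mulr0 oppr0 sub0r.
  have := congr1 (fun z => b * z) r2; rewrite mulr0 !mulrDr !mulrA bb mul0r addr0 bcb.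
  by move/subr0_eq->.
have baca : b * a * c * a = - (a * b * a * c).
  have : a * b * a * c = b * a * b * c by rewrite bab.
  rewrite -(mulrA (b * a)) bc mulrBr mulrN !mulrA -(mulrA b a a) aa mulr0 mul0r oppr0 sub0r.
  by move=> ->; rewrite opprK.
have caba : c * a * b * a = - (a * b * a * c) by rewrite cab.
have aaR z : z * a * a = 0 by rewrite -mulrA aa mulr0.
have acac : a * (c * (a * c)) = 0 by rewrite (mulrA c) cac !mulrA aa !mul0r.
rewrite /sv_eval /fk_eval.
(* For [i >= 12] both sides vanish, by the default of [nth] and the cutoff in [fk_eval]. *)
case: s => [|[|[|s]]] // _; do 12?[case: i => [|i]] => //;
  rewrite /= /fk_mul /fk_word /= ?big_cons ?big_nil /= ?mulr1n ?mulr0n ?mulr0 ?mulr1 ?mulr1z ?mulrNz ?addr0 ?mulrA //;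
  rewrite ?nth_nil ?big_nil -/a -/b -/c; try by rewrite ?(aa, bb, cc, mul0r).
- by rewrite bab aaR.
- by rewrite bab aaR mul0r.
- by rewrite cac aaR.
- by rewrite cba mulNr -!mulrA acac oppr0.
- by rewrite cab -!mulrA acac mulr0.
Qed.
End FominKirillov.

(** * Spanning sets and top degree terms of Verma modules *)

Lemma ordS_neq2 (c : 'I_3) : c != ordS (ordS c).
Proof. by case: c => [[|[|[|]]]]. Qed.

Lemma ordSS_S (c : 'I_3) : ordS (ordS (ordS c)) = c.
Proof. by apply: val_inj; case: c => [[|[|[|]]]]. Qed.

Lemma trE (i j : 'I_3) (ij : i != j) (c : 'I_3) :
  c = i /\ ordS c = j \/ c = j /\ ordS c = i -> tr ij = ctr c.
Proof.
by move=> h; apply: val_inj => /=; case: h => [[-> ->]|[-> ->]] //; apply: tpermC.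
Qed.

(** This decides which of the two mixed relations of [D] applies to a product of a [y] and an
    [x]. *)
Lemma transp_eqVshare (s t : transp) : s = t \/
  exists i j l (ij : i != j) (il : i != l) (jl : j != l), s = tr ij /\ t = tr il.
Proof.
have [a <-] := ctr_surj s; have [b <-] := ctr_surj t.
have [->|ab] := eqVneq a b; [by left | right].
have neq1 c : ordS c != c :> 'I_3 by rewrite eq_sym ctr_subproof.
have [->|->] : b = ordS a \/ b = ordS (ordS a).
- case: a b ab => [[|[|[|]]]] //= ? [[|[|[|]]]] //= ? _;
  by [left; apply: val_inj | right; apply: val_inj].
- exists (ordS a), a, (ordS (ordS a)), (neq1 a), (ctr_subproof (ordS a)), (ordS_neq2 a).
  by rewrite (trE _ (or_intror (conj erefl erefl))); split.
exists a, (ordS a), (ordS (ordS a)), (ctr_subproof a), (ordS_neq2 a), (ctr_subproof (ordS a)).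
split=> //; symmetry; apply: trE; right; split=> //; exact: ordSS_S.
Qed.

Section DoubleRelations.
Variable k : fieldType.
Local Notation X s := (D_x k (ctr (inord s))).

Lemma DS3_to_D_g a : DS3_to_D (DS3_g k a) = D_g k a.
Proof. by rewrite /DS3_to_D /DS3_lift /DS3_g palg_liftE falg_eval_letter. Qed.

Lemma DS3_to_D_d a : DS3_to_D (DS3_d k a) = D_d k a.
Proof. by rewrite /DS3_to_D /DS3_lift /DS3_d palg_liftE falg_eval_letter. Qed.

Lemma D_x_sq (t : transp) : D_x k t * D_x k t = 0.
Proof. by apply/D_relP/D_FKx/FK_sq. Qed.

(** Up to rotating the summands, the three-term relation has two forms, one for each cyclic order of
    the three transpositions; the other one follows. *)
Lemma D_x_cyc (c : 'I_3) : let x i := D_x k (ctr i) in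
  x c * x (ordS c) + x (ordS c) * x (ordS (ordS c)) + x (ordS (ordS c)) * x c = 0.
Proof.
have neq1 : ordS c != c by rewrite eq_sym ctr_subproof.
have := D_relP (D_FKx _ _ _ (FK_tri (D_x k) neq1 (ctr_subproof (ordS c)) (ordS_neq2 c))).
rewrite (trE neq1 (or_intror (conj erefl erefl))).
rewrite (@trE _ _ (ordS_neq2 c) (ordS (ordS c))); last by right; rewrite ordSS_S.
by rewrite -/(ctr (ordS c)) => E /=; rewrite -[RHS]E [RHS]addrAC.
Qed.

Lemma D_x_cyc' (c : 'I_3) : let x i := D_x k (ctr i) in
  x c * x (ordS (ordS c)) + x (ordS (ordS c)) * x (ordS c) + x (ordS c) * x c = 0.
Proof.
have := D_relP (D_FKx _ _ _ (FK_tri (D_x k) (ctr_subproof c) (ordS_neq2 c) (ctr_subproof (ordS c)))).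
rewrite (@trE _ _ (ordS_neq2 c) (ordS (ordS c))); last by right; rewrite ordSS_S.
by rewrite -/(ctr (ordS c)) => E /=; rewrite -[RHS]E [RHS]addrAC.
Qed.

Lemma ordS_inord (n : nat) : (n < 2)%N -> ordS (inord n : 'I_3) = inord n.+1.
Proof. by case: n => [|[|]] // _; apply: val_inj; rewrite /= !inordK. Qed.

(** The basis of B(V) inside [D]; [xw 11] is the top degree element w. *)
Definition xw (i : nat) : D k := fk_eval (fun s => X s) i.

Lemma xw0 : xw 0 = 1.
Proof. by rewrite /xw /fk_eval big_nil mulr1n. Qed.

Lemma x_xw s i : (s < 3)%N -> X s * xw i = sv_eval xw (fk_mul s i).
Proof.
move=> s3; apply: (@fk_mulE _ (fun s => X s)) => // [t _||].
- exact: D_x_sq.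
- by have := D_x_cyc (inord 0); rewrite !ordS_inord.
- by have := D_x_cyc' (inord 0); rewrite !ordS_inord.
Qed.

(* The expansion of [w_i * w_j]. *)
Definition fk_mulw (i j : nat) : svec :=
  foldr (fun s => sv_lin (fk_mul s)) [:: (j, 1%Z)] (fk_word i).

Lemma xw_xw i j : (i < 12)%N -> xw i * xw j = sv_eval xw (fk_mulw i j).
Proof.
move=> i12; rewrite {1}/xw /fk_eval i12 mulr1n /fk_mulw.
have : all (fun s => s < 3)%N (fk_word i) by move: i i12; do 12?[case=> //].
elim: (fk_word i) => [|s v IH] /=; first by rewrite big_nil mul1r sv_eval1.
case/andP=> s3 /IH; rewrite big_cons -mulrA => ->.
rewrite mulr_sv_eval sv_eval_lin; apply: eq_sv_eval => l /=.
exact: x_xw.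
Qed.

Section Spanning.
Variable N : lmodType (DS3 k).
Implicit Types (u v : verma N) (n : N).

(** The spanning half of the triangular decomposition: vectors of this form are shown to be stable
    under all generators of [D]. That the coefficients [m] are unique comes later from the matrix
    representations. *)
Definition spanned u : Prop := exists m : nat -> N, u = \sum_(i < 12) tens (xw i) (m i).

Lemma spannedD u v : spanned u -> spanned v -> spanned (u + v).
Proof.
move=> [m ->] [m' ->]; exists (fun i => m i + m' i).
by rewrite -big_split; apply: eq_bigr => i _; rewrite raddfD.
Qed.

Lemma spannedN u : spanned u -> spanned (- u).
Proof.
move=> [m ->]; exists (fun i => - m i).
by rewrite -sumrN; apply: eq_bigr => i _; rewrite raddfN.
Qed.

Lemma spanned_tens i n : spanned (tens (xw i) n).
Proof.
have [i12|i12] := ltnP i 12.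
  exists (fun l => if l == i then n else 0).
  rewrite (bigD1 (Ordinal i12)) //= eqxx big1 ?addr0 // => l.
  by rewrite -val_eqE /= => /negPf->; rewrite raddf0.
exists (fun=> 0); rewrite big1 => [|l _]; last exact: raddf0.
have -> : xw i = 0 by rewrite /xw /fk_eval ltnNge i12.
by rewrite tensE scale0r.
Qed.

Lemma spanned_sum (I : Type) (r : seq I) (F : I -> verma N) :
  (forall i, spanned (F i)) -> spanned (\sum_(i <- r) F i).
Proof.
move=> sF; elim/big_ind: _ => //; last exact: spannedD.
by exists (fun=> 0); rewrite big1 // => i _; apply: raddf0.
Qed.

Lemma spanned_x t u : spanned u -> spanned (D_x k t *: u).
Proof.
have [s <-] := ctr_surj t; rewrite -(inord_val s) => -[m ->].
rewrite scaler_sumr; apply: spanned_sum => i.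
rewrite tensZ x_xw ?ltn_ord // tensE /sv_eval scaler_suml; apply: spanned_sum => p.
by rewrite -scalerMzl -tensE -raddfMz; apply: spanned_tens.
Qed.

Lemma spanned_word (v : seq transp) n : spanned ((\prod_(t <- v) D_x k t) *: tens 1 n).
Proof.
elim: v => [|t v IH]; last by rewrite big_cons -scalerA; apply: spanned_x.
by rewrite big_nil scale1r -xw0; apply: spanned_tens.
Qed.

(** Passing from the twelve words to arbitrary products of the [x] makes induction on the length of
    a word available. *)
Lemma spanned_op (z : D k) u :
    (forall (v : seq transp) n, spanned (z *: ((\prod_(t <- v) D_x k t) *: tens 1 n))) ->
  spanned u -> spanned (z *: u).
Proof.
move=> sz [m ->]; rewrite scaler_sumr; apply: spanned_sum => i.
have := sz [seq ctr (inord s) | s <- fk_word i] (m i).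
by rewrite big_map => h; rewrite tensE /xw /fk_eval ltn_ord mulr1n; apply: h.
Qed.

Lemma spanned_tens1 n : spanned (tens 1 n).
Proof. by rewrite -xw0; apply: spanned_tens. Qed.

Lemma spanned_g a u : spanned u -> spanned (D_g k a *: u).
Proof.
apply: spanned_op => v n; elim: v => [|t v IH].
  by rewrite big_nil scale1r -DS3_to_D_g DS3_tens; apply: spanned_tens1.
rewrite big_cons -scalerA scalerA (D_relP (D_gx _ _ _ _ a t)) -mulrA -scalerA -scalerA.
have gw : spanned (D_x k (conjt a t) *: (D_g k a *: ((\prod_(s <- v) D_x k s) *: tens 1 n))).
  exact/spanned_x/IH.
by case: (odd_perm a); [rewrite expr1 scaleN1r; apply: spannedN | rewrite expr0 scale1r].
Qed.

Lemma spanned_d h u : spanned u -> spanned (D_d k h *: u).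
Proof.
apply: spanned_op => v n; elim: v h => [|t v IH] h.
  by rewrite big_nil scale1r -DS3_to_D_d DS3_tens; apply: spanned_tens1.
rewrite big_cons -scalerA scalerA (D_relP (D_dx _ _ _ _ h t)) -scalerA.
exact: spanned_x.
Qed.

(** The [y] is moved past the first letter by a mixed relation. This leaves some [y] on a shorter
    word, covered by induction for all [t], and terms with group elements and idempotents only. *)
Lemma spanned_y t u : spanned u -> spanned (D_y k t *: u).
Proof.
apply: spanned_op => v n; elim: v t => [|s v IH] t.
  rewrite big_nil scale1r y_tens; exists (fun=> 0).
  by rewrite big1 // => i _; apply: raddf0.
rewrite big_cons -scalerA; set w := _ *: tens 1 n; have sw := spanned_word v n : spanned w.
have [<-|[i [j [l [ij [il [jl [-> ->]]]]]]]] := transp_eqVshare s t.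
  have := D_relP (D_yx (D_g k) (D_d k) (D_x k) (D_y k) s).
  move/(canRL (addrK _)) => E; rewrite scalerA E scalerBl scalerDl scale1r.
  apply: spannedD; last by apply/spannedN; rewrite -scalerA; apply/spanned_x/IH.
  apply: spannedD; first exact: sw.
  rewrite -scalerA scalerBl; apply/spanned_g.
  by apply/spannedD/spannedN; apply: spanned_d.
have := D_relP (D_yx' (D_g k) (D_d k) (D_x k) (D_y k) ij il jl).
move/(canRL (addrK _)) => E; rewrite scalerA E scalerBl.
apply: spannedD; last by apply/spannedN; rewrite -scalerA; apply/spanned_x/IH.
rewrite -scalerA scalerBl; apply/spanned_g.
by apply/spannedD/spannedN; apply: spanned_d.
Qed.

Lemma verma_spanned u : spanned u.
Proof.
elim/verma_ind: u => [u v|a n]; first exact: spannedD.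
rewrite tensE; have: spanned (tens 1 n) by apply: spanned_tens1.
move: (tens 1 n) => u; elim/palg_ind: a u => [a b IHa IHb|a b IHa IHb|c|[t|t|h|h]] u su.
- by rewrite scalerDl; apply: spannedD; [apply: IHa | apply: IHb].
- by rewrite -scalerA; apply/IHa/IHb.
- case: su => m ->; exists (fun i => (c%:A : DS3 k) *: m i).
  rewrite scaler_sumr; apply: eq_bigr => i _.
  rewrite tensE [RHS]tensE -DS3_tens linearZ /= rmorph1 !scalerA.
  by rewrite mulr_algl mulr_algr.
- exact: spanned_x.
- exact: spanned_y.
- exact: spanned_g.
- exact: spanned_d.
Qed.

End Spanning.
End DoubleRelations.

(** The Frobenius property of B(V) in coordinates: in this order of the words the pairing into the
    top degree is triangular up to reversal, with diagonal entries 1 or -1 by the next lemma. *)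
Lemma fk_mulw_dual i j : (i < 12)%N -> (i <= j < 12)%N ->
  sv_eqb (fk_mulw (11 - i) j) (if i == j then [:: (11%N, sv_coef (fk_mulw (11 - i) i) 11)] else [::]).
Proof.
have : all (fun i => all (fun j => (i <= j)%N ==>
    sv_eqb (fk_mulw (11 - i) j)
      (if i == j then [:: (11%N, sv_coef (fk_mulw (11 - i) i) 11)] else [::]))
  (iota 0 12)) (iota 0 12) by vm_compute.
move=> /allP h i12 /andP[ij j12]; have /h/allP/(_ j) : i \in iota 0 12 by rewrite mem_iota.
by rewrite mem_iota ij; apply.
Qed.

Lemma fk_mulw_sign i : (i < 12)%N -> sv_coef (fk_mulw (11 - i) i) 11 \in [:: 1; -1].
Proof.
have /allP h : all (fun i => sv_coef (fk_mulw (11 - i) i) 11 \in [:: 1; -1]) (iota 0 12).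
  by vm_compute.
by move=> i12; apply: h; rewrite mem_iota.
Qed.

(* If [i] is minimal among the basis words occurring in [u], then multiplying [u]
   by the dual word [w_{11-i}] leaves only a top degree term. *)
Lemma verma_top (k : fieldType) (N : lmodType (DS3 k)) (u : verma N) : u != 0 ->
  exists (a : D k) (n : N), n != 0 /\ a *: u = tens (xw k 11) n.
Proof.
have [m Eu] := verma_spanned u => uN0.
have exm : exists i, (i < 12)%N && (m i != 0).
  case: (pselect (exists i, (i < 12)%N && (m i != 0))) => // none.
  case/eqP: uN0; rewrite Eu big1 // => i _.
  have -> : m i = 0; last exact: raddf0.
  by apply/eqP; apply: contra_notT none => mi; exists i; rewrite ltn_ord.
have [i /andP[i12 miN0] imin] := ex_minnP exm.
pose c := sv_coef (fk_mulw (11 - i) i) 11.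
exists (xw k (11 - i)), (m i *~ c); split.
  have := fk_mulw_sign i12; rewrite -/c !inE => /orP[]/eqP->; first by rewrite mulr1z.
  by rewrite mulrNz mulr1z oppr_eq0.
rewrite Eu scaler_sumr (bigD1 (Ordinal i12)) //= big1 ?addr0 => [|j ji].
  rewrite tensZ xw_xw; last by rewrite ltnS leq_subr.
  have := fk_mulw_dual i12 (_ : i <= i < 12)%N; rewrite leqnn i12 eqxx => /(_ isT)/sv_eqbP->.
  by rewrite /sv_eval big_seq1 [RHS]raddfMz tensE -scalerMzl -tensE.
have [ij|ij] := ltnP j i.
  have -> : m j = 0; last by rewrite raddf0 scaler0.
  apply/eqP; apply: contraTT ij => mj; rewrite -leqNgt.
  by apply: imin; rewrite ltn_ord.
rewrite tensZ xw_xw; last by rewrite ltnS leq_subr.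
have := fk_mulw_dual i12 (_ : i <= j < 12)%N; rewrite ij ltn_ord => /(_ isT)/sv_eqbP->.
move: ji; rewrite -val_eqE /= eq_sym => /negPf->.
by rewrite sv_eval_nil tensE scale0r.
Qed.

(** * Matrix representations *)

(* A permutation [a] of [{0, 1, 2}] is encoded by the list [[:: a 0; a 1; a 2]]. *)
Definition perms3 : seq (seq nat) :=
  [:: [:: 0; 1; 2]; [:: 1; 0; 2]; [:: 0; 2; 1]; [:: 2; 1; 0]; [:: 1; 2; 0]; [:: 2; 0; 1]]%N.

Definition transps3 : seq (seq nat) := [:: [:: 1; 0; 2]; [:: 0; 2; 1]; [:: 2; 1; 0]]%N.

Definition transp_code (s : nat) : seq nat := nth [::] transps3 s.
Definition code_mul (p q : seq nat) : seq nat := [seq nth 0%N p i | i <- q].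
Definition code_inv (p : seq nat) : seq nat := [seq index i p | i <- iota 0 3].
Definition code_conj (p : seq nat) (s : nat) : nat :=
  index (code_mul (code_mul p (transp_code s)) (code_inv p)) transps3.
(** In [S_3] the odd permutations are exactly the transpositions. *)
Definition code_sign (p : seq nat) : int := if p \in transps3 then -1 else 1.

(* The tables of a module with basis [w_i (x) n_m], where [i < 12], [m < n0] and
   [n_m] is a basis of D(S_3)-weight vectors, indexed by [i * n0 + m]. *)
Section VermaTables.
Variables (n0 : nat) (deg0 : nat -> seq nat) (g0 : seq nat -> nat -> nat * int).

(** Since [delta_h x_t = x_t delta_(th)], applying [x_t] multiplies the degree by [t] on the
    left. *)
Definition vdeg (b : nat) : seq nat :=
  foldr (fun s d => code_mul (transp_code s) d) (deg0 (b %% n0)%N) (fk_word (b %/ n0)).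

Definition x_col (s b : nat) : svec :=
  [seq ((p.1 * n0 + b %% n0)%N, p.2) | p <- fk_mul s (b %/ n0)].

Definition sv_norm (v : svec) : svec :=
  [seq p <- [seq (i, sv_coef v i) | i <- iota 0 (12 * n0)] | p.2 != 0].

(** The group element is pushed through the word: each letter contributes a sign and is conjugated,
    and the rest acts on the base vector. *)
Definition g_col (p : seq nat) (b : nat) : svec :=
  sv_norm (foldr (fun s v => sv_scale (code_sign p) (sv_lin (x_col (code_conj p s)) v))
    [:: g0 p (b %% n0)%N] (fk_word (b %/ n0))).

Definition d_col (p : seq nat) (b : nat) : svec :=
  if vdeg b == p then [:: (b, 1)] else [::].

(* The recursion is y_t x_s = - x_s y_{sts} + [s = t] + g_s (delta_t - delta_{ts}),
   which covers both relations between the [y]'s and the [x]'s, started from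
   y_t n_m = 0. *)
Fixpoint y_word (t : nat) (w : seq nat) (m : nat) : svec :=
  if w is s :: w' then
    let b := (index w' fk_words * n0 + m)%N in
    sv_scale (-1) (sv_lin (x_col s) (y_word (code_conj (transp_code s) t) w' m))
    ++ (if s == t then [:: (b, 1)] else [::])
    ++ (if vdeg b == transp_code t then g_col (transp_code s) b else [::])
    ++ (if vdeg b == code_mul (transp_code t) (transp_code s) then sv_scale (-1) (g_col (transp_code s) b)
        else [::])
  else [::].

Definition y_col (t b : nat) : svec := sv_norm (y_word t (fk_word (b %/ n0)) (b %% n0)).

Definition tabulate (f : nat -> svec) : seq svec := mkseq f (12 * n0).

End VermaTables.

Record tables := Tables {
  tab_x : seq (seq svec); tab_y : seq (seq svec);
  tab_g : seq (seq svec); tab_d : seq (seq svec) }.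

Definition verma_tables n0 deg0 g0 : tables := Tables
  [seq tabulate n0 (x_col n0 s) | s <- iota 0 3]
  [seq tabulate n0 (y_col n0 deg0 g0 s) | s <- iota 0 3]
  [seq tabulate n0 (g_col n0 g0 p) | p <- perms3]
  [seq tabulate n0 (d_col n0 deg0 p) | p <- perms3].

(** Evaluated once, so that the checks run on literal tables. The single base vector has degree e
    and is fixed by the group. *)
Definition e_tables : tables := Eval vm_compute in
  verma_tables 1 (fun=> [:: 0; 1; 2]%N) (fun _ _ => (0%N, 1)).

(** The base vectors are [|12>], [|23>], [|13>], permuted by conjugation up to sign. *)
Definition sigma_tables : tables := Eval vm_compute in
  verma_tables 3 transp_code (fun p m => (code_conj p m, code_sign p)).

(** * Operators on formal combinations and boolean checks of the relations *)

Section Operators.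
Implicit Types f g : nat -> svec.

Definition op_mul f g (b : nat) : svec := sv_lin f (g b).
Definition op_add f g (b : nat) : svec := f b ++ g b.
Definition op_scale c f (b : nat) : svec := sv_scale c (f b).
Definition op_sub f g := op_add f (op_scale (-1) g).
Definition op_one (b : nat) : svec := [:: (b, 1)].
Definition op_zero (b : nat) : svec := [::].
Definition op_eqb n f g : bool := all (fun b => sv_eqb (f b) (g b)) (iota 0 n).

End Operators.

Section Checks.
Variables (n : nat) (T : tables).

Definition op_x s := nth [::] (nth [::] (tab_x T) s).
Definition op_y s := nth [::] (nth [::] (tab_y T) s).
Definition op_g p := nth [::] (nth [::] (tab_g T) (index p perms3)).
Definition op_d p := nth [::] (nth [::] (tab_d T) (index p perms3)).

(** Guarantees empty columns beyond [n], so that cutting operators down to matrices respects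
    composition. *)
Definition size_check : bool :=
  all (all (fun t => size t <= n)%N) [:: tab_x T; tab_y T; tab_g T; tab_d T].

Definition DS3_check : bool :=
  [&& op_eqb n (op_g [:: 0; 1; 2]%N) op_one,
      op_eqb n (fun b => flatten [seq op_d p b | p <- perms3]) op_one &
      all (fun p => all (fun q =>
        [&& op_eqb n (op_mul (op_g p) (op_g q)) (op_g (code_mul p q)),
            op_eqb n (op_mul (op_d p) (op_d q)) (if p == q then op_d p else op_zero) &
            op_eqb n (op_mul (op_d p) (op_g q))
              (op_mul (op_g q) (op_d (code_mul (code_mul (code_inv q) p) q)))]) perms3) perms3].

(** Distinct [s], [t], [u] stand for (ij), (ik), (jk), here and in [yx_check]. *)
Definition FK_check (op : nat -> nat -> svec) : bool :=
  all (fun s => op_eqb n (op_mul (op s) (op s)) op_zero &&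
    all (fun t => all (fun u => uniq [:: s; t; u] ==>
      op_eqb n (op_add (op_add (op_mul (op s) (op t)) (op_mul (op u) (op s)))
                       (op_mul (op t) (op u))) op_zero)
    (iota 0 3)) (iota 0 3)) (iota 0 3).

Definition mixed_check : bool :=
  all (fun p => all (fun s =>
    [&& op_eqb n (op_mul (op_g p) (op_x s))
          (op_scale (code_sign p) (op_mul (op_x (code_conj p s)) (op_g p))),
        op_eqb n (op_mul (op_d p) (op_x s)) (op_mul (op_x s) (op_d (code_mul (transp_code s) p))),
        op_eqb n (op_mul (op_d p) (op_y s)) (op_mul (op_y s) (op_d (code_mul (transp_code s) p))) &
        op_eqb n (op_mul (op_y s) (op_g p))
          (op_scale (code_sign p) (op_mul (op_g p) (op_y (code_conj (code_inv p) s))))])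
    (iota 0 3)) perms3.

Definition yx_check : bool :=
  all (fun s =>
    op_eqb n (op_add (op_mul (op_y s) (op_x s)) (op_mul (op_x s) (op_y s)))
      (op_add op_one (op_mul (op_g (transp_code s)) (op_sub (op_d (transp_code s)) (op_d [:: 0; 1; 2]%N)))) &&
    all (fun t => all (fun u => uniq [:: s; t; u] ==>
      op_eqb n (op_add (op_mul (op_y t) (op_x s)) (op_mul (op_x s) (op_y u)))
        (op_mul (op_g (transp_code s)) (op_sub (op_d (transp_code t)) (op_d (code_mul (transp_code t) (transp_code s))))))
    (iota 0 3)) (iota 0 3)) (iota 0 3).

Definition rep_check : bool :=
  [&& size_check, DS3_check, FK_check op_x, FK_check op_y, mixed_check & yx_check].

End Checks.

Lemma e_tables_check : rep_check 12 e_tables.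
Proof. by vm_compute. Qed.

Lemma sigma_tables_check : rep_check 36 sigma_tables.
Proof. by vm_compute. Qed.

(** * Comparison of [S_3] with its encoding by lists *)

Definition perm_code (a : 'S_3) : seq nat := [seq val (a (inord i)) | i <- iota 0 3].

Definition transp_idx (t : transp) : nat := index (perm_code t) transps3.

Lemma nth_perm_code (a : 'S_3) (i : 'I_3) : nth 0%N (perm_code a) i = a i.
Proof. by rewrite (nth_map 0%N) ?size_iota // nth_iota // add0n inord_val. Qed.

Lemma perm_codeM (a b : 'S_3) : perm_code (a ∘ b) = code_mul (perm_code a) (perm_code b).
Proof.
by rewrite /code_mul -map_comp; apply: eq_map => i; rewrite -[RHS]/(nth _ _ (b _)) nth_perm_code permM.
Qed.

Lemma perm_code1 : perm_code 1%g = [:: 0; 1; 2]%N.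
Proof. by rewrite /perm_code /= !perm1 !inordK. Qed.

Lemma perm_code_inj : injective perm_code.
Proof.
move=> a b ab; apply/permP => i; apply: val_inj.
by have := nth_perm_code a i; rewrite ab nth_perm_code => /esym.
Qed.

Lemma perm_code_ctr (i : 'I_3) : perm_code (ctr i) = transp_code i.
Proof.
rewrite /perm_code /= /tperm !permE /=.
case: i => [[|[|[|i]]]] //= ?; rewrite -!val_eqE /= !inordK //.
Qed.

Lemma mem_perm_code a : perm_code a \in perms3.
Proof.
have : uniq (perm_code a).
  rewrite map_inj_in_uniq ?iota_uniq // => i j; rewrite !mem_iota => i3 j3.
  by move/val_inj/perm_inj/(congr1 val); rewrite /= !inordK.
rewrite /perm_code /=; move: (a _) (a _) (a _) => i j l.
case: i j l => [[|[|[|i]]]] //= ? [[|[|[|j]]]] //= ? [[|[|[|l]]]] //= ?.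
Qed.

Lemma perm_codeV (a : 'S_3) : perm_code a^-1%g = code_inv (perm_code a).
Proof.
apply: (@eq_from_nth _ 0%N) => [|i]; rewrite !size_map // => i3.
rewrite -[i]/(val (@Ordinal 3 i i3)); move: (Ordinal _) => {i3}i.
rewrite nth_perm_code (nth_map 0%N) ?size_iota ?ltn_ord // nth_iota ?ltn_ord // add0n.
have := nth_perm_code a (a^-1%g i); rewrite permKV => E.
rewrite -[X in index X]E index_uniq ?size_map //.
rewrite map_inj_in_uniq ?iota_uniq // => j l; rewrite !mem_iota => j3 l3.
by move/val_inj/perm_inj/(congr1 val); rewrite /= !inordK.
Qed.

Lemma transp_idx_ctr (i : 'I_3) : transp_idx (ctr i) = i.
Proof. by rewrite /transp_idx perm_code_ctr; case: i => [[|[|[|]]]]. Qed.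

Lemma transp_idx_lt t : (transp_idx t < 3)%N.
Proof. by have [i <-] := ctr_surj t; rewrite transp_idx_ctr. Qed.

Lemma transp_idx_inj : injective transp_idx.
Proof.
move=> s t; have [i <-] := ctr_surj s; have [j <-] := ctr_surj t.
by rewrite !transp_idx_ctr => /val_inj->.
Qed.

Lemma transp_code_transp_idx t : transp_code (transp_idx t) = perm_code t.
Proof. by have [i <-] := ctr_surj t; rewrite transp_idx_ctr perm_code_ctr. Qed.

Lemma transp_idx_conjt a t : transp_idx (conjt a t) = code_conj (perm_code a) (transp_idx t).
Proof. by rewrite /code_conj transp_code_transp_idx -perm_codeV -!perm_codeM. Qed.

Lemma code_sign_perm_code a : code_sign (perm_code a) = (-1) ^+ a.
Proof.
have odd_ctr (i : 'I_3) : odd_perm (ctr i) by rewrite odd_tperm ctr_subproof.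
have ctr_eq (i : 'I_3) : perm_code a = transp_code i -> a = ctr i by rewrite -perm_code_ctr => /perm_code_inj.
(* The two 3-cycles are products of two listed transpositions, hence even. *)
have rot_eq (i j : 'I_3) : perm_code a = code_mul (transp_code i) (transp_code j) -> a = (ctr i : 'S_3) ∘ ctr j.
  by rewrite -!perm_code_ctr -perm_codeM => /perm_code_inj.
have := mem_perm_code a; rewrite !inE => /or4P[/eqP E|/eqP E|/eqP E|/or3P[]/eqP E].
- by rewrite E; have -> : a = 1%g; [by apply: perm_code_inj; rewrite E perm_code1 | rewrite odd_perm1].
- by rewrite E (ctr_eq (@Ordinal 3 0 isT) E) odd_ctr.
- by rewrite E (ctr_eq (@Ordinal 3 1 isT) E) odd_ctr.
- by rewrite E (ctr_eq (@Ordinal 3 2 isT) E) odd_ctr.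
- by rewrite E (rot_eq (@Ordinal 3 0 isT) (@Ordinal 3 1 isT) E) odd_permM !odd_ctr.
- by rewrite E (rot_eq (@Ordinal 3 1 isT) (@Ordinal 3 0 isT) E) odd_permM !odd_ctr.
Qed.

(** [perm_code] is injective into a list of six elements and [S_3] has order six, so its values
    exhaust the list. *)
Lemma sum_perm_code (V : nmodType) (F : seq nat -> V) :
  \sum_a F (perm_code a) = \sum_(p <- perms3) F p.
Proof.
rewrite -big_enum /= -(big_map perm_code xpredT F) -/(codom perm_code); apply: perm_big.
have codom_uniq : uniq (codom perm_code) by rewrite map_inj_uniq ?enum_uniq //; exact: perm_code_inj.
have sub : {subset codom perm_code <= perms3} by move=> _ /codomP[a ->]; exact: mem_perm_code.
apply: uniq_perm => //; apply: (uniq_min_size codom_uniq sub _).2.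
by rewrite size_codom card_Sn.
Qed.

(** * From checked tables to an algebra map into matrices *)

Section MatrixRepresentation.
Variables (k : fieldType) (n : nat).
Implicit Types f g : nat -> svec.

Definition op_mx f : 'M[k]_n.+1 :=
  \matrix_(i, j) sv_eval (fun l => (l == i :> nat)%:R) (f j).

(** Coordinates of [g b] beyond [n] are lost in the matrix of [g], but [f] sends the corresponding
    basis vectors to 0 anyway. *)
Lemma op_mxM f g : (forall b, (n < b)%N -> f b = [::]) ->
  op_mx (op_mul f g) = op_mx f * op_mx g.
Proof.
move=> f0; apply/matrixP => i j; rewrite !mxE sv_eval_lin {1}/sv_eval.
under [RHS]eq_bigr do rewrite !mxE /(sv_eval _ (g j)) mulr_sumr.
rewrite exchange_big; apply: eq_bigr => p _ /=.
have [pn|pn] := ltnP p.1 n.+1.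
  rewrite (bigD1 (Ordinal pn)) //= eqxx big1 ?addr0 => [|l].
    by rewrite mulrzAr mulr1.
  by rewrite -val_eqE /= eq_sym => /negPf->; rewrite mul0rz mulr0.
rewrite f0 // sv_eval_nil mul0rz big1 // => l _.
by rewrite gtn_eqF ?mul0rz ?mulr0 // (leq_trans (ltn_ord l)).
Qed.

Lemma op_mxD f g : op_mx (op_add f g) = op_mx f + op_mx g.
Proof. by apply/matrixP => i j; rewrite !mxE sv_eval_cat. Qed.

Lemma op_mxZ c f : op_mx (op_scale c f) = c%:~R *: op_mx f.
Proof. by apply/matrixP => i j; rewrite !mxE sv_eval_scale mulrzl. Qed.

Lemma op_mxB f g : op_mx (op_sub f g) = op_mx f - op_mx g.
Proof. by rewrite op_mxD op_mxZ mulrNz mulr1z scaleN1r. Qed.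

Lemma op_mx1 : op_mx op_one = 1.
Proof. by apply/matrixP => i j; rewrite !mxE sv_eval1 eq_sym. Qed.

Lemma op_mx0 : op_mx op_zero = 0.
Proof. by apply/matrixP => i j; rewrite !mxE sv_eval_nil. Qed.

Lemma op_mx_flatten (I : Type) (r : seq I) (F : I -> nat -> svec) :
  op_mx (fun b => flatten [seq F x b | x <- r]) = \sum_(x <- r) op_mx (F x).
Proof.
elim: r => [|x r IH]; first by rewrite big_nil -op_mx0.
by rewrite big_cons -IH -op_mxD.
Qed.

Lemma op_eqbP f g : op_eqb n.+1 f g -> op_mx f = op_mx g.
Proof.
move=> /allP fg; apply/matrixP => i j; rewrite !mxE; apply/sv_eqbP/fg.
by rewrite mem_iota /=.
Qed.

Variable T : tables.
Hypothesis T_check : rep_check n.+1 T.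

Lemma table_oob (Ts : seq (seq svec)) s b : all (fun t => size t <= n.+1)%N Ts ->
  (n < b)%N -> nth [::] (nth [::] Ts s) b = [::].
Proof.
move=> /allP szT nb; have [sT|sT] := ltnP s (size Ts); last by rewrite (nth_default _ sT) nth_nil.
by rewrite nth_default // (leq_trans (szT _ (mem_nth _ sT))).
Qed.

Lemma size_tables : all (all (fun t => size t <= n.+1)%N) [:: tab_x T; tab_y T; tab_g T; tab_d T].
Proof. by have /and5P[] := T_check. Qed.

Lemma op_x_oob s b : (n < b)%N -> op_x T s b = [::].
Proof. by apply: table_oob; have /and5P[] := size_tables. Qed.
Lemma op_y_oob s b : (n < b)%N -> op_y T s b = [::].
Proof. by apply: table_oob; have /and5P[] := size_tables. Qed.
Lemma op_g_oob p b : (n < b)%N -> op_g T p b = [::].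
Proof. by apply: table_oob; have /and5P[] := size_tables. Qed.
Lemma op_d_oob p b : (n < b)%N -> op_d T p b = [::].
Proof. by apply: table_oob; have /and5P[] := size_tables. Qed.

Definition mx_g (a : 'S_3) := op_mx (op_g T (perm_code a)).
Definition mx_d (a : 'S_3) := op_mx (op_d T (perm_code a)).
Definition mx_x (t : transp) := op_mx (op_x T (transp_idx t)).
Definition mx_y (t : transp) := op_mx (op_y T (transp_idx t)).

Lemma mem_transp_idx t : transp_idx t \in iota 0 3.
Proof. by rewrite mem_iota transp_idx_lt. Qed.

Lemma transp_idx_uniq i j l (ij : i != j) (il : i != l) (jl : j != l) :
  uniq [:: transp_idx (tr ij); transp_idx (tr il); transp_idx (tr jl)].
Proof.
have neq s t : (val s : 'S_3) i != (val t : 'S_3) i -> transp_idx s != transp_idx t.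
  by apply: contra_neq => /transp_idx_inj->.
rewrite /= !inE negb_or !andbT -andbA; apply/and3P; split; apply: neq.
- by rewrite /= !tpermL.
- by rewrite /= tpermL tpermD 1?eq_sym // eq_sym.
- by rewrite /= tpermL tpermD 1?eq_sym // eq_sym.
Qed.

Lemma FK_checkP (op : nat -> nat -> svec) :
    FK_check n.+1 op -> (forall s b, (n < b)%N -> op s b = [::]) ->
  forall u v, FK_rel (fun t => op_mx (op (transp_idx t))) u v -> u = v.
Proof.
move=> /allP chk oob u v [t|i j l ij il jl].
  have /chk/andP[/op_eqbP E _] := mem_transp_idx t.
  by rewrite -op_mxM ?E ?op_mx0 //; apply: oob.
have /chk/andP[_ /allP/(_ _ (mem_transp_idx (tr il)))/allP/(_ _ (mem_transp_idx (tr jl)))] := mem_transp_idx (tr ij).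
rewrite transp_idx_uniq => /op_eqbP; rewrite !op_mxD !op_mxM ?op_mx0; [by [] | exact: oob..].
Qed.

Lemma mx_rel u v : D_rel mx_g mx_d mx_x mx_y u v -> u = v.
Proof.
have /and5P[_ /and3P[g1 d1 /allP DS] FKx FKy /andP[/allP mixed /allP yx]] := T_check.
have oob := (op_x_oob, op_y_oob, op_g_oob, op_d_oob).
have mxM f g : (forall b, (n < b)%N -> f b = [::]) -> op_mx f * op_mx g = op_mx (op_mul f g).
  by move/op_mxM->.
have gM s g : op_mx (op_g T s) * op_mx g = op_mx (op_mul (op_g T s) g) by apply/mxM/op_g_oob.
have dM s g : op_mx (op_d T s) * op_mx g = op_mx (op_mul (op_d T s) g) by apply/mxM/op_d_oob.
have xM s g : op_mx (op_x T s) * op_mx g = op_mx (op_mul (op_x T s) g) by apply/mxM/op_x_oob.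
have yM s g : op_mx (op_y T s) * op_mx g = op_mx (op_mul (op_y T s) g) by apply/mxM/op_y_oob.
have sgnZ a f : (-1) ^+ odd_perm a * op_mx f = op_mx (op_scale (code_sign (perm_code a)) f).
  rewrite op_mxZ code_sign_perm_code; case: (odd_perm a).
    by rewrite !expr1 mulN1r mulrNz scaleN1r.
  by rewrite !expr0 mul1r scale1r.
case=> {u v}.
- move=> u v [|a b|a b||h a].
  + by rewrite /mx_g perm_code1 (op_eqbP g1) op_mx1.
  + have /DS/allP/(_ _ (mem_perm_code b))/and3P[E _ _] := mem_perm_code a.
    by rewrite /mx_g gM (op_eqbP E) perm_codeM.
  + have /DS/allP/(_ _ (mem_perm_code b))/and3P[_ E _] := mem_perm_code a.
    rewrite /mx_d dM (op_eqbP E) (inj_eq perm_code_inj); case: eqP => // _; exact: op_mx0.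
  + by rewrite /mx_d (sum_perm_code (fun p => op_mx (op_d T p))) -op_mx_flatten (op_eqbP d1) op_mx1.
  + have /DS/allP/(_ _ (mem_perm_code a))/and3P[_ _ E] := mem_perm_code h.
    by rewrite /mx_d /mx_g dM (op_eqbP E) gM !perm_codeM perm_codeV.
- by apply: FK_checkP => //; apply: op_x_oob.
- by apply: FK_checkP => //; apply: op_y_oob.
- move=> a t; have /mixed/allP/(_ _ (mem_transp_idx t))/and4P[E _ _ _] := mem_perm_code a.
  by rewrite /mx_g /mx_x gM (op_eqbP E) -mulrA xM sgnZ transp_idx_conjt.
- move=> h t; have /mixed/allP/(_ _ (mem_transp_idx t))/and4P[_ E _ _] := mem_perm_code h.
  by rewrite /mx_d /mx_x dM (op_eqbP E) xM perm_codeM transp_code_transp_idx.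
- move=> h t; have /mixed/allP/(_ _ (mem_transp_idx t))/and4P[_ _ E _] := mem_perm_code h.
  by rewrite /mx_d /mx_y dM (op_eqbP E) yM perm_codeM transp_code_transp_idx.
- move=> t a; have /mixed/allP/(_ _ (mem_transp_idx t))/and4P[_ _ _ E] := mem_perm_code a.
  by rewrite /mx_g /mx_y yM (op_eqbP E) -mulrA gM sgnZ transp_idx_conjt perm_codeV.
- move=> t; have /yx/andP[/op_eqbP E _] := mem_transp_idx t.
  rewrite /mx_g /mx_d /mx_x /mx_y yM xM -op_mxD E op_mxD op_mx1 -gM op_mxB.
  by rewrite transp_code_transp_idx perm_code1.
move=> i j l ij il jl.
have /yx/andP[_ /allP/(_ _ (mem_transp_idx (tr il)))/allP/(_ _ (mem_transp_idx (tr jl)))] := mem_transp_idx (tr ij).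
rewrite transp_idx_uniq => /op_eqbP E.
rewrite /mx_g /mx_d /mx_x /mx_y yM xM -op_mxD E -gM op_mxB.
by rewrite !transp_code_transp_idx perm_codeM.
Qed.

Definition mx_rep : D k -> 'M[k]_n.+1 := palg_lift (P := D_pres k) (D_fun_rel mx_rel).
HB.instance Definition _ := GRing.LRMorphism.on mx_rep.

Lemma mx_rep_x t : mx_rep (D_x k t) = mx_x t.
Proof. by rewrite /mx_rep /D_x palg_liftE falg_eval_letter. Qed.
Lemma mx_rep_y t : mx_rep (D_y k t) = mx_y t.
Proof. by rewrite /mx_rep /D_y palg_liftE falg_eval_letter. Qed.
Lemma mx_rep_g a : mx_rep (D_g k a) = mx_g a.
Proof. by rewrite /mx_rep /D_g palg_liftE falg_eval_letter. Qed.
Lemma mx_rep_d a : mx_rep (D_d k a) = mx_d a.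
Proof. by rewrite /mx_rep /D_d palg_liftE falg_eval_letter. Qed.

End MatrixRepresentation.

(** * Embedding a Verma module into its table representation *)

Section VermaRepresentation.
Variables (k : fieldType) (n0 n : nat) (T : tables) (T_check : rep_check n.+1 T).

Definition sv_col (v : svec) : colmod (@mx_rep k n T T_check) :=
  (\col_i sv_eval (fun l => (l == i :> nat)%:R) v : 'cV[k]_n.+1).

Lemma op_mx_col f v : (forall b, (n < b)%N -> f b = [::]) ->
  op_mx k n f *m (sv_col v : 'cV_n.+1) = sv_col (sv_lin f v).
Proof.
move=> f0; apply/colP => i; have /matrixP/(_ i 0) := op_mxM k (n := n) (fun=> v) f0.
by rewrite !mxE => ->; apply: eq_bigr => j _; rewrite !mxE.
Qed.

Lemma sv_col_cat v w : sv_col (v ++ w) = sv_col v + sv_col w.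
Proof. by apply/colP => i; rewrite !mxE sv_eval_cat. Qed.

Lemma sv_col_eqb v w : sv_eqb v w -> sv_col v = sv_col w.
Proof. by move/sv_eqbP => E; apply/colP => i; rewrite !mxE E. Qed.

Lemma rep_x t v : D_x k t *: sv_col v = sv_col (sv_lin (op_x T (transp_idx t)) v).
Proof.
rewrite -[LHS]/(mx_rep T_check _ *m _) mx_rep_x; apply: op_mx_col; exact: op_x_oob.
Qed.
Lemma rep_y t v : D_y k t *: sv_col v = sv_col (sv_lin (op_y T (transp_idx t)) v).
Proof.
rewrite -[LHS]/(mx_rep T_check _ *m _) mx_rep_y; apply: op_mx_col; exact: op_y_oob.
Qed.
Lemma rep_g a v : D_g k a *: sv_col v = sv_col (sv_lin (op_g T (perm_code a)) v).
Proof.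
rewrite -[LHS]/(mx_rep T_check _ *m _) mx_rep_g; apply: op_mx_col; exact: op_g_oob.
Qed.
Lemma rep_d a v : D_d k a *: sv_col v = sv_col (sv_lin (op_d T (perm_code a)) v).
Proof.
rewrite -[LHS]/(mx_rep T_check _ *m _) mx_rep_d; apply: op_mx_col; exact: op_d_oob.
Qed.

Definition op_word (w : seq nat) (v : svec) : svec := foldr (fun s => sv_lin (op_x T s)) v w.

Lemma rep_xw i v : (i < 12)%N -> xw k i *: sv_col v = sv_col (op_word (fk_word i) v).
Proof.
move=> i12; rewrite /xw /fk_eval i12 mulr1n.
have : all (fun s => s < 3)%N (fk_word i) by move: i i12; do 12?[case=> //].
elim: (fk_word i) => [|s w IH] /=; first by rewrite big_nil scale1r.
case/andP=> s3 /IH E; rewrite big_cons -scalerA E rep_x transp_idx_ctr inordK //.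
Qed.

Variable r : {rmorphism DS3 k -> 'M[k]_n0.+1}.

(** The inclusion of the degree 0 part: the empty word has index 0, so base vector [m] is basis
    vector [m]. *)
Definition base_mx : 'M[k]_(n.+1, n0.+1) := \matrix_(i, j) (i == j :> nat)%:R.

Hypothesis r_scale : forall c : k, r c%:A = c%:M.
Hypothesis r_g : forall a, base_mx *m r (DS3_g k a) = mx_g k n T a *m base_mx.
Hypothesis r_d : forall a, base_mx *m r (DS3_d k a) = mx_d k n T a *m base_mx.
Hypothesis base_check : (n.+1 == 12 * n0.+1)%N &&
  all (fun m => all (fun s => op_y T s m == [::]) (iota 0 3) &&
    all (fun i => sv_eqb (op_word (fk_word i) [:: (m, 1)]) [:: ((i * n0.+1 + m)%N, 1)])
      (iota 0 12)) (iota 0 n0.+1).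

Lemma base_mx_DS3 b : base_mx *m r b = mx_rep T_check (DS3_to_D b) *m base_mx.
Proof.
elim/palg_ind: b => [a b IHa IHb|a b IHa IHb|c|[a|a]].
- by rewrite (rmorphD r) (rmorphD (@DS3_to_D k)) (rmorphD (mx_rep T_check)) mulmxDr mulmxDl IHa IHb.
- rewrite (rmorphM r) (rmorphM (@DS3_to_D k)) (rmorphM (mx_rep T_check)) mulmxA IHa.
  by rewrite -mulmxA IHb mulmxA.
- rewrite r_scale [DS3_to_D _]linearZ /= rmorph1 linearZ /= rmorph1.
  by rewrite -scalemx1 -scalemxAr -scalemxAl mul1mx mulmx1.
- by rewrite [DS3_to_D _]DS3_to_D_g mx_rep_g r_g.
- by rewrite [DS3_to_D _]DS3_to_D_d mx_rep_d r_d.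
Qed.

Lemma base_mx_ket (m : 'I_n0.+1) : base_mx *m delta_mx m 0 = sv_col [:: (m : nat, 1)].
Proof.
apply/colP => i; rewrite -colE !mxE sv_eval1.
by rewrite eq_sym.
Qed.

(** The map is induced by [base_mx]. It is injective because [xw k i] sends base vector [m] to basis
    vector [i * n0.+1 + m], so the coefficients of a spanned vector are coordinates of its image. *)
Lemma verma_rep : exists f : {linear verma (colmod r) -> colmod (@mx_rep k n T T_check)},
  (forall u, f u = 0 -> u = 0) /\
  (forall a (m : 'I_n0.+1), f (@tens k (colmod r) a (delta_mx m 0 : 'cV[k]_n0.+1)) = a *: sv_col [:: (m : nat, 1)]).
Proof.
have /andP[/eqP En /allP base] := base_check.
pose j (x : colmod r) : colmod (@mx_rep k n T T_check) := base_mx *m x.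
have [|b x|t x|f fE] := @verma_lift k (colmod r) _ j.
- by move=> x y; apply: mulmxDr.
- by rewrite -[LHS]/(base_mx *m (r b *m x)) mulmxA base_mx_DS3 -mulmxA.
- rewrite -[LHS]/(mx_rep T_check _ *m (base_mx *m x)) mulmxA.
  suff -> : mx_rep T_check (D_y k t) *m base_mx = 0 by rewrite mul0mx.
  apply/matrixP => i m.
  have -> : (mx_rep T_check (D_y k t) *m base_mx) i m = (D_y k t *: sv_col [:: (m : nat, 1)] : 'cV_n.+1) i 0.
    by rewrite -[_ *: _]/(mx_rep T_check _ *m sv_col _) -base_mx_ket mulmxA -colE [RHS]mxE.
  have /base/andP[/allP/(_ _ (mem_transp_idx t))/eqP y0 _] : (m : nat) \in iota 0 n0.+1 by rewrite mem_iota ltn_ord.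
  rewrite rep_y; have -> : sv_lin (op_y T (transp_idx t)) [:: (m : nat, 1)] = [::] by rewrite /sv_lin /= y0.
  by rewrite !mxE sv_eval_nil.
exists f; split; last by move=> a m; rewrite fE /j base_mx_ket.
move=> u; have [m ->] := verma_spanned u => fu0; apply: big1 => i _.
suff -> : m i = 0 by apply: raddf0.
apply/colP => l.
have lt_n : (i * n0.+1 + l < n.+1)%N.
  rewrite En (leq_trans (n := (i * n0.+1 + n0.+1)%N)) ?ltn_add2l ?ltn_ord //.
  by rewrite addnC -mulSn leq_mul2r ltn_ord orbT.
have wordE (i' : 'I_12) (p : 'I_n.+1) (q : 'I_n0.+1) :
    (mx_rep T_check (xw k i') *m base_mx) p q = (i' * n0.+1 + q == p)%N%:R.
  have -> : (mx_rep T_check (xw k i') *m base_mx) p q =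
      (xw k i' *: sv_col [:: (q : nat, 1)] : 'cV_n.+1) p 0.
    by rewrite -[_ *: _]/(mx_rep T_check _ *m sv_col _) -base_mx_ket mulmxA -colE [RHS]mxE.
  have /base/andP[_ /allP/(_ i')] : (q : nat) \in iota 0 n0.+1 by rewrite mem_iota ltn_ord.
  rewrite mem_iota ltn_ord => /(_ isT)/sv_col_eqb E.
  by rewrite rep_xw ?ltn_ord // E mxE sv_eval1.
have := congr1 (fun w : 'cV_n.+1 => w (Ordinal lt_n) 0) fu0.
have -> : f (\sum_(i0 < 12) tens (xw k i0) (m i0)) =
    \sum_(i0 < 12) ((mx_rep T_check (xw k i0) *m base_mx) *m (m i0 : 'cV_n0.+1)) :> 'cV_n.+1.
  rewrite linear_sum; apply: eq_bigr => i' _; rewrite fE /j.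
  by rewrite -[LHS]/(mx_rep T_check _ *m _) mulmxA.
rewrite summxE (bigD1 i) //= mxE (bigD1 l) //= wordE eqxx mul1r.
rewrite !big1 ?addr0 => [->|i' i'i|l' l'l]; first by rewrite !mxE.
  rewrite mxE big1 // => l' _; rewrite wordE; case: eqP => [E|_]; last by rewrite mul0r.
  case/eqP: i'i; apply: val_inj.
  have := congr1 (divn^~ n0.+1) E; rewrite /= !divnMDl // !divn_small ?ltn_ord //.
  by rewrite !addn0.
by rewrite wordE /= eqn_add2l (inj_eq val_inj) (negPf l'l) mul0r.
Qed.

End VermaRepresentation.

Lemma op_mx_base (k : fieldType) (n0 n : nat) f (i : 'I_n.+1) (j : 'I_n0.+1) : (n0 <= n)%N ->
  (op_mx k n f *m base_mx k n0 n) i j = sv_eval (fun l => (l == i :> nat)%:R) (f j).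
Proof.
move=> n0n; have jn : (j < n.+1)%N by rewrite (leq_trans (ltn_ord j)).
rewrite mxE (bigD1 (Ordinal jn)) //= big1 ?addr0 => [|l]; rewrite !mxE /=.
  by rewrite eqxx mulr1.
by rewrite -val_eqE /= => /negPf->; rewrite mulr0.
Qed.

(** * The representations of dimensions 12 and 36 *)

Section ConcreteVermas.
Variable k : fieldType.

Lemma DS3_lift_g (A : algType k) (g d : 'S_3 -> A) (H : forall u v, DS3_rel g d u v -> u = v) a :
  DS3_lift H (DS3_g k a) = g a.
Proof. by rewrite /DS3_lift /DS3_g palg_liftE falg_eval_letter. Qed.

Lemma DS3_lift_d (A : algType k) (g d : 'S_3 -> A) (H : forall u v, DS3_rel g d u v -> u = v) a :
  DS3_lift H (DS3_d k a) = d a.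
Proof. by rewrite /DS3_lift /DS3_d palg_liftE falg_eval_letter. Qed.

Local Notation rep_e := (colmod (@mx_rep k 11 _ e_tables_check)).
Local Notation rep_s := (colmod (@mx_rep k 35 _ sigma_tables_check)).

Lemma DS3_lift_scalar (A : algType k) (g d : 'S_3 -> A) (H : forall u v, DS3_rel g d u v -> u = v) c :
  DS3_lift H c%:A = c%:A.
Proof. by rewrite [LHS]palg_lift_scale rmorph1. Qed.

Lemma verma_e_rep : exists f : {linear verma (M_e_plus k) -> rep_e},
  (forall u, f u = 0 -> u = 0) /\
  (forall a, f (@tens k (M_e_plus k) a (delta_mx 0 0 : 'cV[k]_1)) =
    a *: sv_col k e_tables_check [:: (0%N, 1)]).
Proof.
have [|a|a||f [f0 fE]] := @verma_rep k 0 11 _ e_tables_check (DS3_lift (@ep_rel k)).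
- by move=> c; rewrite [LHS]DS3_lift_scalar scalemx1.
- rewrite [X in _ *m X](DS3_lift_g (@ep_rel k) a) /ep_g mulmx1.
  apply/matrixP => i j; rewrite op_mx_base // !mxE (ord1 j) /=.
  have /allP/(_ _ (mem_perm_code a))/eqP-> :
    all (fun p => op_g e_tables p 0 == [:: (0%N, 1)]) perms3 by vm_compute.
  by rewrite sv_eval1 eq_sym.
- rewrite [X in _ *m X](DS3_lift_d (@ep_rel k) a).
  apply/matrixP => i j; rewrite op_mx_base // (ord1 j) /= mxE big_ord1 /ep_d.
  have /allP/(_ _ (mem_perm_code a))/eqP-> :
    all (fun p => op_d e_tables p 0 == if p == [:: 0; 1; 2]%N then [:: (0%N, 1)] else [::]) perms3.
    by vm_compute.
  rewrite -perm_code1 (inj_eq perm_code_inj).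
  by case: eqP => _; rewrite ?sv_eval1 ?sv_eval_nil /= ?mulr1n ?mulr0n !mxE ?mulr1 ?mulr0 // eq_sym.
- by vm_compute.
by exists f; split=> // a; have := fE a 0.
Qed.

Lemma verma_sigma_rep : exists f : {linear verma (M_sigma_minus k) -> rep_s},
  (forall u, f u = 0 -> u = 0) /\
  (forall a m, f (tens a (ket k m)) = a *: sv_col k sigma_tables_check [:: (m : nat, 1)]).
Proof.
have [|a|a||f [f0 fE]] := @verma_rep k 2 35 _ sigma_tables_check (DS3_lift (@sm_rel k)).
- by move=> c; rewrite [LHS]DS3_lift_scalar scalemx1.
- rewrite [X in _ *m X](DS3_lift_g (@sm_rel k) a).
  apply/matrixP => i m; rewrite op_mx_base //.
  have /allP/(_ _ (mem_perm_code a))/allP/(_ m) : all (fun p => all (fun m =>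
      op_g sigma_tables p m == [:: (code_conj p m, code_sign p)]) (iota 0 3)) perms3 by vm_compute.
  rewrite mem_iota ltn_ord => /(_ isT)/eqP->.
  have [m' Em'] := ctr_surj (conjt a (ctr m)).
  rewrite -{1}(transp_idx_ctr m) -transp_idx_conjt -Em' transp_idx_ctr code_sign_perm_code.
  rewrite /sv_eval big_seq1 /= mxE (bigD1 m') //= big1 ?addr0 => [|l lm']; rewrite !mxE -Em'.
    rewrite eqxx mulr1n eq_sym; case: (odd_perm a); last by rewrite !expr0 mulr1 mulr1z.
    by rewrite !expr1 mulrN1 mulrNz mulr1z.
  by rewrite (inj_eq ctr_inj) (negPf lm') mulr0n mulr0.
- rewrite [X in _ *m X](DS3_lift_d (@sm_rel k) a).
  apply/matrixP => i m; rewrite op_mx_base //.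
  have /allP/(_ _ (mem_perm_code a))/allP/(_ m) : all (fun p => all (fun m =>
      op_d sigma_tables p m == if p == transp_code m then [:: (m, 1)] else [::]) (iota 0 3)) perms3.
    by vm_compute.
  rewrite mem_iota ltn_ord => /(_ isT)/eqP->.
  rewrite mxE (bigD1 m) //= big1 ?addr0 => [|l lm]; rewrite !mxE; last first.
    by rewrite (negPf lm) mulr0.
  have -> : transp_code m = perm_code (ctr m) by rewrite -transp_code_transp_idx transp_idx_ctr.
  rewrite eqxx /= (inj_eq perm_code_inj).
  by case: (a == _); rewrite ?sv_eval1 ?sv_eval_nil ?mulr0 // mulr1 eq_sym.
- by vm_compute.
by exists f; split=> // a m; have := fE a m.
Qed.

End ConcreteVermas.

(** * Modules on which D acts by the counit *)

Section TrivialModules.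
Variable k : fieldType.

(* Sealed, because unification problems between distinct elements of the quotient
   algebra [D k] make the unifier unfold the quotient. *)
Lemma D_eps_sig : {f : {rmorphism D k -> k} |
  [/\ forall t, f (D_x k t) = 0, forall t, f (D_y k t) = 0, forall a, f (D_g k a) = 1,
      forall a, f (D_d k a) = (a == 1%g)%:R & forall c, f c%:A = c]}.
Proof.
exists (palg_lift (P := D_pres k) (D_fun_rel (@D_counit k)) : {rmorphism D k -> k^o}).
split=> [t|t|a|a|c]; last by rewrite [LHS]palg_lift_scale rmorph1; apply: mulr1.
- by rewrite /D_x [LHS]palg_liftE falg_eval_letter.
- by rewrite /D_y [LHS]palg_liftE falg_eval_letter.
- by rewrite /D_g [LHS]palg_liftE falg_eval_letter.
- by rewrite /D_d [LHS]palg_liftE falg_eval_letter.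
Qed.

Definition D_eps : {rmorphism D k -> k} := sval D_eps_sig.

Lemma D_eps_x t : D_eps (D_x k t) = 0.
Proof. by rewrite /D_eps; case: D_eps_sig => f []. Qed.
Lemma D_eps_y t : D_eps (D_y k t) = 0.
Proof. by rewrite /D_eps; case: D_eps_sig => f []. Qed.
Lemma D_eps_g a : D_eps (D_g k a) = 1.
Proof. by rewrite /D_eps; case: D_eps_sig => f []. Qed.
Lemma D_eps_d a : D_eps (D_d k a) = (a == 1%g)%:R.
Proof. by rewrite /D_eps; case: D_eps_sig => f []. Qed.
Lemma D_eps_scalar c : D_eps c%:A = c.
Proof. by rewrite /D_eps; case: D_eps_sig => f []. Qed.

(* Sealed for the same reason. *)
Lemma kscale_sig : {f : forall V : lmodType (D k), k -> V -> V |
  forall V c v, f V c v = (c%:A : D k) *: v}.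
Proof. by exists (fun V c v => (c%:A : D k) *: v). Qed.

Definition kscale (V : lmodType (D k)) : k -> V -> V := sval kscale_sig V.

Lemma kscaleE (V : lmodType (D k)) c (v : V) : (c%:A : D k) *: v = kscale c v.
Proof. by rewrite /kscale (svalP kscale_sig). Qed.

Section Kscale.
Variable V : lmodType (D k).
Implicit Types (a : D k) (c d : k) (v : V).

Lemma kscaleC a c v : a *: kscale c v = kscale c (a *: v).
Proof. by rewrite -!kscaleE !scalerA mulr_algl mulr_algr. Qed.

Lemma kscaleA c d v : kscale c (kscale d v) = kscale (c * d) v.
Proof.
rewrite -!kscaleE; apply: (etrans (scalerA _ _ v)); congr (_ *: v).
by rewrite mulr_algl (scalerA c d).
Qed.

Lemma kscaleDl c d v : kscale (c + d) v = kscale c v + kscale d v.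
Proof. by rewrite -!kscaleE -(scalerDl v) (scalerDl 1 c d). Qed.

Lemma kscale0l v : kscale 0 v = 0.
Proof. by rewrite -kscaleE (scale0r (1 : D k)) (scale0r v). Qed.

Lemma kscale1 v : kscale 1 v = v.
Proof. by rewrite -kscaleE (scale1r (1 : D k)) (scale1r v). Qed.

Lemma kscaleBr c u v : kscale c (u - v) = kscale c u - kscale c v.
Proof. by rewrite -!kscaleE; apply: scalerBr. Qed.

Lemma kscale0r c : kscale c (0 : V) = 0.
Proof. by rewrite -kscaleE; apply: scaler0. Qed.

Lemma kscale_eq0 c v : kscale c v = 0 -> v != 0 -> c = 0.
Proof.
move=> cv0 vN0; apply/eqP; apply: contraNT vN0 => cN0.
by rewrite -[v]kscale1 -(mulVf cN0) -kscaleA cv0 kscale0r.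
Qed.

Lemma kscale_mem (U : submodule V) c v : v \in U -> kscale c v \in U.
Proof. by rewrite -kscaleE; apply: rpredZ. Qed.

Lemma kscale_memE (U : submodule V) c v : c != 0 -> (kscale c v \in U) -> v \in U.
Proof.
move=> cN0 /(kscale_mem c^-1); by rewrite kscaleA mulVf // kscale1.
Qed.

End Kscale.

Lemma palg_morph_eq (P : presentation k) (A : nzRingType) (f h : {rmorphism palg P -> A}) :
    (forall c, f c%:A = h c%:A) -> (forall i, f (pclass (letter k i)) = h (pclass (letter k i))) ->
  f =1 h.
Proof.
move=> fhc fhl x; elim/palg_ind: x => [a b IHa IHb|a b IHa IHb|c|i].
- by rewrite (rmorphD f) (rmorphD h) IHa IHb.
- by rewrite (rmorphM f) (rmorphM h) IHa IHb.
- exact: fhc.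
- exact: fhl.
Qed.

(** Congruences modulo [S] pass to products since [S] is a submodule and scalars commute with the
    action. Taking [F] to be the identity or [DS3_to_D] treats both algebras at once. *)
Lemma palg_act_cong (P : presentation k) (F : {rmorphism palg P -> D k})
    (e : {rmorphism palg P -> k}) (V : lmodType (D k)) (S : submodule V) (q : V) :
    (forall c, F c%:A *: q - kscale (e c%:A) q \in S) ->
    (forall i, F (pclass (letter k i)) *: q - kscale (e (pclass (letter k i))) q \in S) ->
  forall b, F b *: q - kscale (e b) q \in S.
Proof.
move=> Sc Sl; elim/palg_ind => [a b IHa IHb|a b IHa IHb|c|i]; [| |exact: Sc|exact: Sl].
  rewrite (rmorphD F) (rmorphD e) scalerDl kscaleDl opprD addrACA; exact: rpredD.
rewrite (rmorphM F) (rmorphM e) -scalerA -[F b *: q](subrK (kscale (e b) q)) scalerDr -addrA.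
apply: rpredD; first exact: rpredZ.
by rewrite kscaleC mulrC -kscaleA -kscaleBr; apply: kscale_mem.
Qed.

Lemma DS3_lift_ep b : DS3_lift (@ep_rel k) b = (D_eps (DS3_to_D b))%:M.
Proof.
pose h : {rmorphism DS3 k -> 'M[k]_1} := @scalar_mx k 1 \o (D_eps \o (@DS3_to_D k)).
apply: (@palg_morph_eq (DS3_pres k) _ (DS3_lift (@ep_rel k)) h) => [c|[a|a]].
- by rewrite [LHS]palg_lift_scale rmorph1 /h /= [DS3_to_D _]palg_lift_scale rmorph1 D_eps_scalar scalemx1.
- by rewrite [LHS]DS3_lift_g /h /= [DS3_to_D _]DS3_to_D_g D_eps_g.
- by rewrite [LHS]DS3_lift_d /h /= [DS3_to_D _]DS3_to_D_d D_eps_d /ep_d; case: (a == 1%g); rewrite ?raddf0.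
Qed.

Lemma ep_act (b : DS3 k) (v : M_e_plus k) : (b *: v : 'cV_1) 0 0 = D_eps (DS3_to_D b) * (v : 'cV_1) 0 0.
Proof. by rewrite -[_ *: _]/(DS3_lift (@ep_rel k) b *m v) DS3_lift_ep mul_scalar_mx mxE. Qed.

Section CounitAction.
Variables (V : lmodType (D k)) (q : V).
Hypothesis gq : forall a, D_g k a *: q = q.
Hypothesis dq : forall a, D_d k a *: q = kscale (a == 1%g)%:R q.

Lemma D_eps_cong (S : submodule V) :
    (forall t, D_x k t *: q \in S) -> (forall t, D_y k t *: q \in S) ->
  forall b : D k, b *: q - kscale (D_eps b) q \in S.
Proof.
move=> xq yq; apply: (@palg_act_cong (D_pres k) idfun D_eps) => [c|[t|t|a|a]] /=.
- by rewrite D_eps_scalar kscaleE subrr rpred0.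
- by rewrite D_eps_x kscale0l subr0; apply: xq.
- by rewrite D_eps_y kscale0l subr0; apply: yq.
- by rewrite D_eps_g kscale1 gq subrr rpred0.
- by rewrite D_eps_d dq subrr rpred0.
Qed.

Fact zero_submodP : submod_closed (pred1 (0 : V)).
Proof. by split=> [|a u v]; rewrite !inE // => /eqP-> /eqP->; rewrite scaler0 addr0. Qed.

Lemma D_eps_act :
    (forall t, D_x k t *: q = 0) -> (forall t, D_y k t *: q = 0) ->
  forall b : D k, b *: q = kscale (D_eps b) q.
Proof.
move=> xq yq b; apply: subr0_eq; apply/eqP.
by apply: (@D_eps_cong (Submodule zero_submodP)) => t; apply/eqP.
Qed.

Lemma DS3_eps_act (b : DS3 k) : DS3_to_D b *: q = kscale (D_eps (DS3_to_D b)) q.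
Proof.
pose e : {rmorphism DS3 k -> k} := D_eps \o (@DS3_to_D k).
apply: subr0_eq; apply/eqP.
apply: (@palg_act_cong (DS3_pres k) (@DS3_to_D k) e _ (Submodule zero_submodP)) => [c|[a|a]];
  apply/eqP; rewrite /e /=.
- by rewrite [DS3_to_D _]palg_lift_scale rmorph1 D_eps_scalar kscaleE subrr.
- by rewrite [DS3_to_D _]DS3_to_D_g D_eps_g kscale1 gq subrr.
- by rewrite [DS3_to_D _]DS3_to_D_d D_eps_d dq subrr.
Qed.

End CounitAction.

(** The common form of the three modules of the theorem. Such a line is unique up to isomorphism,
    simple, of highest weight (e,+), and restricts to M(e,+). *)
Definition is_trivial (V : lmodType (D k)) (q : V) : Prop :=
  [/\ q != 0, forall b, b *: q = kscale (D_eps b) q & forall v, exists c, v = kscale c q].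

Lemma trivial_from (V : lmodType (D k)) (q : V) : is_trivial q ->
  mod_isom (restr D_eps k^o) V.
Proof.
move=> [qN0 act span]; pose f (c : restr D_eps k^o) : V := kscale (c : k) q.
have lin_f : linear f.
  move=> a c d; rewrite /f kscaleDl; congr (_ + _).
  by rewrite kscaleC act kscaleA mulrC.
pose F : {linear restr D_eps k^o -> V} := HB.pack f (GRing.isLinear.Build _ _ _ _ f lin_f).
apply: (@mod_isom_inj_surj _ _ _ F) => [c /kscale_eq0|v]; first exact.
by have [c ->] := span v; exists c.
Qed.

Lemma trivial_isom (V W : lmodType (D k)) (q : V) (r : W) :
  is_trivial q -> is_trivial r -> mod_isom V W.
Proof. by move=> /trivial_from/mod_isom_sym tV /trivial_from; apply: mod_isom_trans. Qed.

Lemma trivial_restr (V : lmodType (D k)) (q : V) : is_trivial q ->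
  mod_isom (restr (@DS3_to_D k) V) (M_e_plus k).
Proof.
move=> [qN0 act span]; apply: mod_isom_sym.
pose f (n : M_e_plus k) : restr (@DS3_to_D k) V := kscale ((n : 'cV_1) 0 0) q.
have lin_f : linear f.
  move=> a c d; rewrite /f mxE kscaleDl ep_act; congr (_ + _).
  by rewrite mulrC -kscaleA -act -[RHS]/(DS3_to_D a *: kscale _ q) kscaleC.
pose F : {linear M_e_plus k -> restr (@DS3_to_D k) V} :=
  HB.pack f (GRing.isLinear.Build _ _ _ _ f lin_f).
apply: (@mod_isom_inj_surj _ _ _ F) => [n /kscale_eq0 n0|v].
  by apply/colP => i; rewrite (ord1 i) n0 // mxE.
have [c ->] := span v; exists (c%:M : 'cV_1).
by rewrite /F /= /f mxE eqxx mulr1n.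
Qed.

Lemma trivial_simple (V : lmodType (D k)) (q : V) : is_trivial q -> is_simple V.
Proof.
move=> [qN0 act span]; split; first by exists q.
move=> U; have [[u Uu uN0]|none] := pselect (exists2 u : V, u \in U & u != 0).
  right=> v; have [c Eu] := span u; have [d ->] := span v; apply: kscale_mem.
  have cN0 : c != 0 by apply: contraNneq uN0 => c0; rewrite Eu c0 kscale0l.
  by apply: kscale_memE cN0 _; rewrite -Eu.
by left=> u Uu; apply/eqP; apply: contra_notT none => uN0; exists u.
Qed.

Fact full_submodP (R : nzRingType) (V : lmodType R) : submod_closed (xpredT : {pred V}).
Proof. by []. Qed.

Lemma trivial_highest_weight (V : lmodType (D k)) (q : V) :
  is_trivial q -> highest_weight V (M_e_plus k).
Proof.
move=> tV; have [qN0 act span] := tV.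
(* The generating submodule is the whole module, every [y] having counit 0. *)
exists (Submodule (@full_submodP _ (restr (@DS3_to_D k) V))); split.
- apply: mod_isom_trans (trivial_restr tV); exact: full_submod_isom.
- move=> t m _; have [c ->] := span m.
  by rewrite kscaleC act D_eps_y kscale0l kscale0r.
- by move=> v; apply/asboolP => U; apply.
Qed.

End TrivialModules.

(** * The Verma module M(e,+) *)

Lemma tens_kscale (k : fieldType) (N : lmodType (DS3 k)) (a : D k) (c : k) (n : N) :
  tens a ((c%:A : DS3 k) *: n) = kscale c (tens a n).
Proof.
rewrite (tensE a) -DS3_tens [DS3_to_D _]palg_lift_scale rmorph1 kscaleE kscaleC.
by rewrite -tensE.
Qed.

Section CounitVerma.
Variable k : fieldType.
Local Notation V := (verma (M_e_plus k)).

Definition ket_e : M_e_plus k := (delta_mx 0 0 : 'cV[k]_1).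

Lemma tens_ket_e (a : D k) (n : M_e_plus k) : tens a n = kscale ((n : 'cV_1) 0 0) (tens a ket_e).
Proof.
rewrite -tens_kscale; congr (tens a _).
rewrite -[_ *: ket_e]/(DS3_lift (@ep_rel k) _ *m ket_e).
rewrite [X in X *m _](DS3_lift_scalar (@ep_rel k)).
by rewrite -scalemxAl mul1mx; apply/colP => i; rewrite (ord1 i) !mxE !eqxx mulr1.
Qed.

(** This map reads off the degree 0 coefficient, as the counit kills all words but the empty one. *)
Lemma verma_e_counit : exists f : {linear V -> restr (D_eps k) k^o},
  forall a, f (tens a ket_e) = D_eps k a.
Proof.
pose j (n : M_e_plus k) : restr (D_eps k) k^o := (n : 'cV_1) 0 0.
have [n n'|b n|t n|f fE] := @verma_lift k (M_e_plus k) _ j.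
- by rewrite /j mxE.
- exact: (ep_act b n).
- by rewrite -[LHS]/(D_eps k (D_y k t) * j n) D_eps_y mul0r.
exists f => a; rewrite fE /j -[LHS]/(D_eps k a * _).
by rewrite [X in _ * X]mxE eqxx mulr1.
Qed.

Lemma D_eps_xw i : D_eps k (xw k i) = (i == 0)%:R.
Proof.
rewrite /xw /fk_eval rmorphMn rmorph_prod.
under eq_bigr do rewrite D_eps_x.
do 12?[case: i => [|i] /=]; rewrite ?big_nil ?big_cons ?mul0r //.
Qed.

(* Multiplying an element with nonzero degree 0 term by [w_i] gives [w_i (x) n] up
   to terms of higher index, so descending induction reaches every [w_i]. *)
Lemma verma_e_full (U : submodule V) (f : {linear V -> restr (D_eps k) k^o}) u :
  (forall a, f (tens a ket_e) = D_eps k a) -> u \in U -> f u != 0 -> forall v, v \in U.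
Proof.
move=> fE Uu fuN0; have [m Eu] := verma_spanned u.
pose c i : k := (m i : 'cV_1) 0 0.
have {}Eu : u = \sum_(i < 12) kscale (c i) (tens (xw k i) ket_e).
  by rewrite Eu; apply: eq_bigr => i _; apply: tens_ket_e.
have c0 : c 0 != 0.
  apply: contraNneq fuN0 => c0; rewrite Eu linear_sum big1 // => i _.
  rewrite -kscaleE linearZ /= fE D_eps_xw -[LHS]/(D_eps k _ * _) D_eps_scalar.
  by case: eqP => [->|_]; rewrite ?c0 ?mul0r ?mulr0.
have Uw i : (i < 12)%N -> tens (xw k i) ket_e \in U.
  move=> i12; have [d] := ubnP (12 - i); elim: d i i12 => // d IH i i12 id.
  have Uwu : xw k i *: u \in U by apply: rpredZ.
  have E : xw k i *: u = kscale (c 0) (tens (xw k i) ket_e) +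
      \sum_(j < 11) kscale (c j.+1) (tens (xw k i * xw k j.+1) ket_e).
    rewrite Eu scaler_sumr big_ord_recl; congr (_ + _).
      by rewrite kscaleC (tensZ (xw k i)) xw0 (mulr1 (xw k i)).
    by apply: eq_bigr => j _; rewrite kscaleC (tensZ (xw k i)).
  suff R : \sum_(j < 11) kscale (c j.+1) (tens (xw k i * xw k j.+1) ket_e) \in U.
    apply: (kscale_memE c0); have := rpredB Uwu R.
    by rewrite E addrK.
  apply: rpred_sum => j _; apply: kscale_mem.
  rewrite xw_xw // tensE /sv_eval scaler_suml.
  rewrite big_seq; apply: rpred_sum => p ip.
  rewrite -scalerMzl -tensE; apply: rpredMz.
  (* A product with a nonempty word has larger degree, and the words are ordered by degree. *)
  have chk : all (fun i => all (fun j => all (fun p => (i < p.1 < 12)%N) (fk_mulw i j)) (iota 1 11))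
    (iota 0 12) by vm_compute.
  have i_in : i \in iota 0 12 by rewrite mem_iota.
  have j_in : j.+1 \in iota 1 11 by rewrite mem_iota; apply: (ltn_ord j).
  have /andP[ip1 p12] := allP (allP (allP chk _ i_in) _ j_in) _ ip.
  by apply: IH => //; rewrite (leq_trans _ (id : 12 - i <= d)%N) // ltn_sub2l.
elim/verma_ind => [x y|a n]; first exact: rpredD.
rewrite tens_ket_e tensE; apply/kscale_mem/rpredZ.
by rewrite -xw0; apply: Uw.
Qed.

End CounitVerma.

(** * Head and socle of M(e,+) *)

Section CounitVermaHead.
Variable k : fieldType.
Local Notation V := (verma (M_e_plus k)).
Local Notation ket := (ket_e k).

Section Radical.
Variable f : {linear V -> restr (D_eps k) k^o}.
Hypothesis fE : forall a, f (tens a ket) = D_eps k a.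

Lemma f_ket : f (tens 1 ket) = 1.
Proof. by rewrite fE rmorph1. Qed.

Lemma submod_kerVfull (U : submodule V) :
  {subset U <= (ker_submod f)} \/ (forall v, v \in U).
Proof.
have [[u Uu fu]|none] := pselect (exists2 u, u \in U & f u != 0).
  by right; apply: verma_e_full fE Uu fu.
by left=> u Uu; apply: contra_notT none => fu; exists u.
Qed.

(** The kernel of [f] is proper and contains every proper submodule, so it is the unique maximal
    one. *)
Lemma rad_verma_e v : (v \in Defs.rad V) = (f v == 0).
Proof.
have ketN : tens 1 ket \notin (ker_submod f).
  by apply/negP => /eqP; rewrite f_ket => /eqP; rewrite oner_eq0.
apply/asboolP/idP => [|fv U [[w wU] maxU]].
  move/(_ (ker_submod f)); apply; split=> [|W _]; first by exists (tens 1 ket).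
  exact: submod_kerVfull.
have [UK|full] := submod_kerVfull U; last by rewrite full in wU.
have [KU|full] := maxU _ UK; first exact: KU.
by rewrite full in ketN.
Qed.

Lemma head_verma_e_trivial : is_trivial (qproj (Defs.rad V) (tens 1 ket) : headmod V).
Proof.
have fk c v : f (kscale c v) = c * (f v : k).
  by rewrite -kscaleE linearZ -[LHS]/(D_eps k _ * _) D_eps_scalar.
have qk c v : kscale c (qproj (Defs.rad V) v : headmod V) = qproj (Defs.rad V) (kscale c v).
  by rewrite -!kscaleE; symmetry; apply: qproj_scale.
split.
- apply/negP => /eqP; rewrite -(raddf0 (qproj (Defs.rad V))) => /qprojP.
  by rewrite subr0 -[_ \in _]/(_ \in Defs.rad V) rad_verma_e f_ket oner_eq0.
- move=> b; rewrite qk; transitivity (qproj (Defs.rad V) (b *: tens 1 ket)).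
    by symmetry; apply: qproj_scale.
  apply/qprojP; rewrite -[_ \in _]/(_ \in Defs.rad V) rad_verma_e raddfB /= fk f_ket mulr1.
  by rewrite -tensE fE subrr.
(* The coefficient of a class is the degree 0 term of a representative. *)
- move=> q; exists (f (generic_quotient.repr q)).
  rewrite qk -[LHS]qproj_repr; apply/qprojP.
  by rewrite -[_ \in _]/(_ \in Defs.rad V) rad_verma_e raddfB /= fk f_ket mulr1 subrr.
Qed.

End Radical.

Definition top_e : V := tens (xw k 11) ket.

(** All five facts are computed on basis vector 11 of the 12-dimensional representation. *)
Lemma top_e_facts :
  [/\ top_e != 0, forall t, D_x k t *: top_e = 0, forall t, D_y k t *: top_e = 0,
      forall a, D_g k a *: top_e = top_e &
      forall a, D_d k a *: top_e = kscale (a == 1%g)%:R top_e].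
Proof.
have [h [h0 hE]] := verma_e_rep k.
have hinj u v : h u = h v -> u = v.
  by move=> huv; apply: subr0_eq; apply: h0; rewrite raddfB /= huv subrr.
have htop : h top_e = sv_col k e_tables_check [:: (11%N, 1)].
  by rewrite /top_e hE rep_xw //; apply: sv_col_eqb; vm_compute.
have sv0 : sv_col k e_tables_check [::] = 0 by apply/colP => i; rewrite !mxE sv_eval_nil.
split.
- apply/eqP => /(congr1 h); rewrite htop linear0 => /(congr1 (fun w : 'cV[k]_12 => w ord_max 0)).
  by rewrite !mxE sv_eval1 => /eqP; rewrite oner_eq0.
- move=> t; apply: h0; rewrite linearZ /= htop rep_x -sv0; apply: sv_col_eqb.
  have /allP : all (fun s => sv_eqb (sv_lin (op_x e_tables s) [:: (11%N, 1)]) [::]) (iota 0 3).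
    by vm_compute.
  by apply; apply: mem_transp_idx.
- move=> t; apply: h0; rewrite linearZ /= htop rep_y -sv0; apply: sv_col_eqb.
  have /allP : all (fun s => sv_eqb (sv_lin (op_y e_tables s) [:: (11%N, 1)]) [::]) (iota 0 3).
    by vm_compute.
  by apply; apply: mem_transp_idx.
- move=> a; apply: hinj; rewrite linearZ /= htop rep_g; apply: sv_col_eqb.
  have /allP : all (fun p => sv_eqb (sv_lin (op_g e_tables p) [:: (11%N, 1)]) [:: (11%N, 1)]) perms3.
    by vm_compute.
  by apply; apply: mem_perm_code.
move=> a; apply: hinj; rewrite linearZ /= htop rep_d.
have /allP/(_ _ (mem_perm_code a))/(sv_col_eqb k e_tables_check)-> : all (fun p =>
    sv_eqb (sv_lin (op_d e_tables p) [:: (11%N, 1)])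
      (if p == [:: 0; 1; 2]%N then [:: (11%N, 1)] else [::])) perms3.
  by vm_compute.
rewrite -perm_code1 (inj_eq perm_code_inj); case: eqP => _; first by rewrite kscale1.
by rewrite kscale0l linear0.
Qed.

Lemma top_e_act b : b *: top_e = kscale (D_eps k b) top_e.
Proof. have [_ tx ty tg td] := top_e_facts; exact: (D_eps_act tg td tx ty b). Qed.

Fact line_e_submodP : submod_closed [pred v : V | `[< exists c, v = kscale c top_e >]].
Proof.
split=> [|a u v /asboolP[c ->] /asboolP[d ->]]; apply/asboolP.
  by exists 0; rewrite kscale0l.
exists (c * D_eps k a + d); rewrite kscaleDl -kscaleA -(top_e_act a).
  by rewrite kscaleC.
Qed.

Lemma socle_verma_e : socle V =i Submodule line_e_submodP.
Proof.
have [topN0 _ _ _ _] := top_e_facts.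
apply: (socle_minimal (v0 := top_e)) => [|//|U u Uu uN0 v /asboolP[c ->]].
  by apply/asboolP; exists 1; rewrite kscale1.
(* Any nonzero submodule contains some w (x) n with [n] nonzero, a nonzero multiple of [top_e]
   because M(e,+) is a line. *)
apply: kscale_mem; have [a [n [nN0 au]]] := verma_top uN0.
have n0 : (n : 'cV_1) 0 0 != 0.
  by apply: contraNneq nN0 => n0; apply/eqP/colP => i; rewrite (ord1 i) n0 mxE.
apply: (kscale_memE n0); rewrite /top_e -tens_ket_e -au; exact: rpredZ.
Qed.

Lemma socle_verma_e_trivial : exists q : submod (socle V), is_trivial q.
Proof.
have [topN0 _ _ _ _] := top_e_facts.
have Stop : top_e \in socle V.
  by rewrite socle_verma_e; apply/asboolP; exists 1; rewrite kscale1.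
have vk c (q : submod (socle V)) : val (kscale c q) = kscale c (val q) by rewrite -!kscaleE.
exists (Sub top_e Stop); split.
- by apply: contraNneq topN0 => /(congr1 val)/= ->.
- by move=> b; apply: val_inj; rewrite vk; apply: top_e_act.
- move=> v; have := valP v; rewrite -[_ \in _]/(val v \in socle V) socle_verma_e.
  by move=> /asboolP[c vE]; exists c; apply: val_inj; rewrite vk.
Qed.

End CounitVermaHead.

(** * The Verma module M(sigma,-) *)

Section SigmaVerma.
Variable k : fieldType.
Local Notation V := (verma (M_sigma_minus k)).

Definition top_s (m : 'I_3) : V := tens (xw k 11) (ket k m).

Lemma tens_ket_s (a : D k) (n : M_sigma_minus k) :
  tens a n = \sum_m kscale ((n : 'cV_3) m 0) (tens a (ket k m)).
Proof.
have nE : n = \sum_m (((n : 'cV_3) m 0)%:A : DS3 k) *: ket k m.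
  have sE c m : (c%:A : DS3 k) *: ket k m = (c *: (delta_mx m 0 : 'cV[k]_3) : 'cV_3).
    rewrite -[LHS]/(DS3_lift (@sm_rel k) _ *m (delta_mx m 0 : 'cV_3)).
    by rewrite [X in X *m _](DS3_lift_scalar (@sm_rel k)) -scalemxAl mul1mx.
  rewrite {1}[n](matrix_sum_delta (n : 'cV_3)); apply: eq_bigr => m _.
  by rewrite big_ord1 sE.
rewrite {1}nE raddf_sum; apply: eq_bigr => m _; exact: tens_kscale.
Qed.

Section Coordinates.
Local Notation col := (sv_col k sigma_tables_check).
Variable h : {linear V -> colmod (@mx_rep k 35 _ sigma_tables_check)}.
Hypothesis h0 : forall u, h u = 0 -> u = 0.
Hypothesis hE : forall a m, h (tens a (ket k m)) = a *: col [:: (m : nat, 1)].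

Lemma h_inj u v : h u = h v -> u = v.
Proof. by move=> huv; apply: subr0_eq; apply: h0; rewrite raddfB /= huv subrr. Qed.

Lemma hZ a v : h (a *: v) = a *: h v.
Proof. exact: linearZ. Qed.

(** The index is [11 * 3 + m]: word 11 on base vector [m]. *)
Lemma h_top m : h (top_s m) = col [:: ((33 + m)%N, 1)].
Proof.
rewrite /top_s hE rep_xw //; apply: sv_col_eqb.
have /allP : all (fun m => sv_eqb (op_word sigma_tables (fk_word 11) [:: (m, 1)]) [:: ((33 + m)%N, 1)])
  (iota 0 3) by vm_compute.
by apply; rewrite mem_iota ltn_ord.
Qed.

(** The indices are [(m + 1) * 3 + m] for [m = 0, 1, 2], since the letter [x_m] is word [m + 1]. *)
Definition e_one_vec : svec := [:: (3%N, 1); (7%N, 1); (11%N, 1)].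

Lemma h_e_one : h (e_one k) = col e_one_vec.
Proof.
rewrite /e_one linear_sum.
transitivity (\sum_(m < 3) col (sv_lin (op_x sigma_tables m) [:: (m : nat, 1)])).
  by apply: eq_bigr => m _; rewrite hE rep_x transp_idx_ctr.
rewrite !big_ord_recl big_ord0 addr0 -!sv_col_cat; apply: sv_col_eqb.
by vm_compute.
Qed.

End Coordinates.

Lemma top_s_neq0 m : top_s m != 0.
Proof.
have [h [h0 hE]] := verma_sigma_rep k.
apply/eqP => /(congr1 h); rewrite (h_top hE) linear0.
have m36 : (33 + m < 36)%N by rewrite ltn_add2l.
move/(congr1 (fun w : 'cV[k]_36 => w (Ordinal m36) 0)).
by rewrite !mxE sv_eval1 eqxx => /eqP; rewrite oner_eq0.
Qed.

(** As (12)(23)(12)(13) = 1, the word w has trivial degree and w|ij> keeps the degree (ij), so the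
    idempotents separate the top vectors. *)
Lemma d_top_s (m l : 'I_3) : D_d k (ctr m) *: top_s l = if l == m then top_s m else 0.
Proof.
have [h [h0 hE]] := verma_sigma_rep k.
apply: (h_inj h0); rewrite hZ (h_top hE) rep_d perm_code_ctr.
have chk : all (fun m => all (fun l => sv_eqb (sv_lin (op_d sigma_tables (transp_code m)) [:: ((33 + l)%N, 1)])
  (if l == m then [:: ((33 + m)%N, 1)] else [::])) (iota 0 3)) (iota 0 3) by vm_compute.
have m_in : (m : nat) \in iota 0 3 by rewrite mem_iota ltn_ord.
have l_in : (l : nat) \in iota 0 3 by rewrite mem_iota ltn_ord.
rewrite (sv_col_eqb k _ (allP (allP chk _ m_in) _ l_in)) val_eqE.
case: (l == m); first by rewrite (h_top hE).
by rewrite linear0; apply/colP => i; rewrite !mxE sv_eval_nil.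
Qed.

Lemma d_tens_top (n : M_sigma_minus k) (m : 'I_3) :
  D_d k (ctr m) *: tens (xw k 11) n = kscale ((n : 'cV_3) m 0) (top_s m).
Proof.
transitivity (\sum_l kscale ((n : 'cV_3) l 0) (D_d k (ctr m) *: top_s l)).
  rewrite tens_ket_s scaler_sumr; apply: eq_bigr => l _; exact: kscaleC.
rewrite (bigD1 m isT) d_top_s eqxx big1 => [|l /negPf lm]; first exact: addr0.
by rewrite d_top_s lm kscale0r.
Qed.

(** The group element is sought among products of two transpositions: these already act transitively
    by conjugation and, being even, introduce no sign. *)
Lemma top_s_transitive (m l : 'I_3) : exists a, top_s l = D_g k a *: top_s m.
Proof.
have [h [h0 hE]] := verma_sigma_rep k.
have chk : all (fun m => all (fun l => has (fun i => has (fun j =>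
  sv_eqb [:: ((33 + l)%N, 1)] (sv_lin (op_g sigma_tables (code_mul (transp_code i) (transp_code j))) [:: ((33 + m)%N, 1)]))
  (iota 0 3)) (iota 0 3)) (iota 0 3)) (iota 0 3) by vm_compute.
have m_in : (m : nat) \in iota 0 3 by rewrite mem_iota ltn_ord.
have l_in : (l : nat) \in iota 0 3 by rewrite mem_iota ltn_ord.
have /hasP[i] := allP (allP chk _ m_in) _ l_in; rewrite mem_iota => i3.
move=> /hasP[j]; rewrite mem_iota => j3 E.
exists ((ctr (Ordinal i3) : 'S_3) ∘ ctr (Ordinal j3)).
apply: (h_inj h0); rewrite (h_top hE l) hZ (h_top hE m) rep_g perm_codeM !perm_code_ctr.
exact: sv_col_eqb E.
Qed.

(** The indices are found by search in the 36-dimensional representation. Writing the vector through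
    a top degree one puts it in the socle. *)
Lemma x_e_one t : exists u v m, D_x k t *: e_one k = D_y k u *: (D_y k v *: top_s m).
Proof.
have [h [h0 hE]] := verma_sigma_rep k.
have chk : all (fun s => has (fun i => has (fun j => has (fun m =>
  sv_eqb (sv_lin (op_x sigma_tables s) e_one_vec)
    (sv_lin (op_y sigma_tables i) (sv_lin (op_y sigma_tables j) [:: ((33 + m)%N, 1)])))
  (iota 0 3)) (iota 0 3)) (iota 0 3)) (iota 0 3) by vm_compute.
have /hasP[i] := allP chk _ (mem_transp_idx t); rewrite mem_iota => i3.
move=> /hasP[j]; rewrite mem_iota => j3 /hasP[m]; rewrite mem_iota => m3 E.
exists (ctr (Ordinal i3)), (ctr (Ordinal j3)), (Ordinal m3).
apply: (h_inj h0); rewrite [LHS]hZ [RHS]hZ [X in _ = _ *: X]hZ (h_top hE) (h_e_one hE).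
rewrite rep_x !rep_y !transp_idx_ctr.
exact: sv_col_eqb E.
Qed.

Lemma y_e_one t : D_y k t *: e_one k = 0.
Proof.
have [h [h0 hE]] := verma_sigma_rep k.
apply: h0; rewrite hZ (h_e_one hE) rep_y.
have chk : all (fun s => sv_eqb (sv_lin (op_y sigma_tables s) e_one_vec) [::]) (iota 0 3).
  by vm_compute.
rewrite (sv_col_eqb k _ (allP chk _ (mem_transp_idx t))).
by apply/colP => i; rewrite !mxE sv_eval_nil.
Qed.

Lemma g_e_one a : D_g k a *: e_one k = e_one k.
Proof.
have [h [h0 hE]] := verma_sigma_rep k.
apply: (h_inj h0); rewrite hZ (h_e_one hE) rep_g; apply: sv_col_eqb.
have /allP : all (fun p => sv_eqb (sv_lin (op_g sigma_tables p) e_one_vec) e_one_vec) perms3.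
  by vm_compute.
by apply; apply: mem_perm_code.
Qed.

Lemma d_e_one a : D_d k a *: e_one k = kscale (a == 1%g)%:R (e_one k).
Proof.
have [h [h0 hE]] := verma_sigma_rep k.
apply: (h_inj h0); rewrite hZ (h_e_one hE) rep_d.
have chk : all (fun p => sv_eqb (sv_lin (op_d sigma_tables p) e_one_vec)
  (if p == [:: 0; 1; 2]%N then e_one_vec else [::])) perms3 by vm_compute.
rewrite (sv_col_eqb k _ (allP chk _ (mem_perm_code a))) -perm_code1 (inj_eq perm_code_inj).
case: eqP => _; first by rewrite kscale1 (h_e_one hE).
by rewrite kscale0l linear0; apply/colP => i; rewrite !mxE sv_eval_nil.
Qed.

(** Word 8 is [x_(12) x_(23) x_(12)]. It kills [x_(12)|12>] as [x_(12)] squares to 0, and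
    [x_(23)|23>] by the braid relation; [x_(13)|13>] goes to w|13>. *)
Lemma xw_e_one : xw k 8 *: e_one k = top_s ord_max.
Proof.
have [h [h0 hE]] := verma_sigma_rep k.
apply: (h_inj h0); rewrite hZ (h_top hE) (h_e_one hE) rep_xw //; apply: sv_col_eqb.
Qed.

End SigmaVerma.

(** * The socle of M(sigma,-) and the quotient of [T10] by it *)

Section SigmaSocle.
Variable k : fieldType.
Local Notation V := (verma (M_sigma_minus k)).

Definition top_submod : submodule V := gen_submod (fun v => exists m, v = top_s k m).

Lemma top_s_mem m : top_s k m \in top_submod.
Proof. by apply/asboolP => U; apply; exists m. Qed.

(** A nonzero submodule contains some nonzero w (x) n; an idempotent cuts it down to a multiple of
    one [top_s], and the group reaches the others. *)
Lemma top_submod_min (U : submodule V) u : u \in U -> u != 0 -> {subset top_submod <= U}.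
Proof.
move=> Uu uN0; have [a [n [nN0 au]]] := verma_top uN0.
have [m nm] : exists m, (n : 'cV_3) m 0 != 0.
  case: (pselect (exists m, (n : 'cV_3) m 0 != 0)) => // none.
  case/eqP: nN0; apply/colP => m; rewrite mxE; apply/eqP.
  by apply: contra_notT none => nm; exists m.
have Um : top_s k m \in U.
  apply: (kscale_memE nm); rewrite -d_tens_top; apply: rpredZ.
  by rewrite -au; apply: rpredZ.
move=> v /asboolP; apply=> _ [l ->].
by have [b ->] := top_s_transitive k m l; apply: rpredZ.
Qed.

Lemma socle_verma_sigma : socle V =i top_submod.
Proof.
exact: (socle_minimal (top_s_mem ord0) (top_s_neq0 k ord0) top_submod_min).
Qed.

Lemma x_e_one_socle t : D_x k t *: e_one k \in socle V.
Proof.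
have [u [v [m ->]]] := x_e_one k t.
by rewrite socle_verma_sigma; do 2!apply: rpredZ; apply: top_s_mem.
Qed.

Lemma e_one_act b : b *: e_one k - kscale (D_eps k b) (e_one k) \in socle V.
Proof.
apply: (D_eps_cong (@g_e_one k) (@d_e_one k)); first exact: x_e_one_socle.
by move=> t; rewrite y_e_one rpred0.
Qed.

(* Otherwise [|e>^1] would lie in the image of the radical of M(e,+) under the
   morphism [|e> |-> |e>^1], so the kernel of this morphism would contain an
   element of nonzero degree 0 term, hence everything. *)
Lemma e_one_notin_socle : e_one k \notin socle V.
Proof.
have [f fE] := verma_e_counit k.
pose j (n : M_e_plus k) : V := kscale ((n : 'cV_1) 0 0) (e_one k).
have [n n'|b n|t n|psi psiE] := @verma_lift k (M_e_plus k) V j.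
- by rewrite /j mxE kscaleDl.
- rewrite /j ep_act mulrC -kscaleA -(DS3_eps_act (@g_e_one k) (@d_e_one k)).
  by rewrite kscaleC.
- by rewrite /j kscaleC y_e_one kscale0r.
have psi_ket a : psi (tens a (ket_e k)) = a *: e_one k.
  by rewrite psiE /j [X in kscale X](_ : _ = 1) ?kscale1 // mxE eqxx.
(* The image under [psi] of the radical of M(e,+). *)
have imP : submod_closed [pred v : V | `[< exists2 u, f u = 0 & psi u = v >]].
  split=> [|a v w /asboolP[v' fv <-] /asboolP[w' fw <-]]; apply/asboolP.
    by exists 0; rewrite linear0.
  by exists (a *: v' + w'); rewrite linearP // fv fw scaler0 addr0.
apply/negP; rewrite socle_verma_sigma => /(top_submod_min (U := Submodule imP)) sub.
have : e_one k \in Submodule imP.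
  apply: sub (top_s_neq0 k ord_max); apply/asboolP.
  (* A word of positive degree lies in the radical, and its image w|13> is nonzero, so the image of
     the radical contains the whole socle. *)
  exists (tens (xw k 8) (ket_e k)); last by rewrite psi_ket xw_e_one.
  by rewrite fE D_eps_xw.
move=> /asboolP[u fu psiu].
have full := @verma_e_full k (ker_submod psi) f (tens 1 (ket_e k) - u) fE.
have : tens 1 (ket_e k) \in ker_submod psi.
  apply: full; last by rewrite raddfB /= fE fu subr0 rmorph1 oner_eq0.
  by rewrite mem_ker_submod raddfB /= psi_ket psiu scale1r subrr.
rewrite mem_ker_submod psi_ket scale1r => /eqP e0.
by have := top_s_neq0 k ord_max; rewrite -xw_e_one e0 scaler0 eqxx.
Qed.

Fact T10_submodP : submod_closed
  [pred v : V | `[< exists (c : k) s, s \in socle V /\ v = kscale c (e_one k) + s >]].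
Proof.
split=> [|a v w /asboolP[c [s [Ss ->]]] /asboolP[d [r [Sr ->]]]]; apply/asboolP.
  by exists 0, 0; rewrite rpred0 kscale0l addr0.
(* The element [a] multiplies |e>^1 by its counit up to an element of the socle, which joins the
   socle part. *)
exists (c * D_eps k a + d), (kscale c (a *: e_one k - kscale (D_eps k a) (e_one k)) + (a *: s + r)).
split.
  by apply: rpredD; [apply/kscale_mem/e_one_act | apply: rpredD => //; apply: rpredZ].
rewrite kscaleDl kscaleBr -kscaleA scalerDr kscaleC.
by rewrite [RHS]addrACA [_ + (_ - _)]addrC subrK addrACA [in RHS]addrA.
Qed.

Definition T10 : submodule V := Submodule T10_submodP.

Lemma T10_is_T10 : is_T10 T10.
Proof.
split; first exact: e_one_notin_socle.
move=> v; split=> [/asboolP[c [s [Ss ->]]]|[c [s [Ss ->]]]].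
  by exists c, s; rewrite kscaleE.
by apply/asboolP; exists c, s; rewrite kscaleE.
Qed.

Lemma T10_quotient_trivial : exists q : quotmod (subpre T10 (socle V)), is_trivial q.
Proof.
have Te : e_one k \in T10.
  by apply/asboolP; exists 1, 0; rewrite rpred0 kscale1 addr0.
pose q0 : submod T10 := Sub (e_one k) Te.
have vk c (q : submod T10) : val (kscale c q) = kscale c (val q) by rewrite -!kscaleE.
have qk c v : kscale c (qproj (subpre T10 (socle V)) v) = qproj _ (kscale c v).
  by rewrite -!kscaleE; symmetry; apply: qproj_scale.
exists (qproj _ q0); split.
- apply/negP => /eqP; rewrite -(raddf0 (qproj _)) => /qprojP; rewrite subr0.
  exact/negP/e_one_notin_socle.
- move=> b; rewrite qk; transitivity (qproj (subpre T10 (socle V)) (b *: q0)).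
    by symmetry; apply: qproj_scale.
  apply/qprojP; rewrite -[_ \in _]/(val (b *: q0 - kscale (D_eps k b) q0) \in socle V).
  rewrite raddfB /= vk; exact: e_one_act.
- move=> q; have /asboolP[c [s [Ss qE]]] := valP (generic_quotient.repr q).
  exists c; rewrite qk -[LHS]qproj_repr; apply/qprojP.
  rewrite -[_ \in _]/(val (generic_quotient.repr q - kscale c q0) \in socle V).
  by rewrite raddfB /= vk qE addrAC subrr add0r.
Qed.

End SigmaSocle.

Unset Implicit Arguments.

Theorem corollary27 (k : closedFieldType) (char0 : [pchar k] =i pred0) :
  (exists T : submodule (verma (M_sigma_minus k)),
    [/\ is_T10 T,
        is_simple (quotmod (subpre T (socle (verma (M_sigma_minus k))))) &
        highest_weight (quotmod (subpre T (socle (verma (M_sigma_minus k)))))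
          (M_e_plus k)]) /\
  mod_isom (restr (@DS3_to_D k) (headmod (verma (M_e_plus k)))) (M_e_plus k) /\
  mod_isom (headmod (verma (M_e_plus k))) (submod (socle (verma (M_e_plus k)))).
Proof.
split.
  have [q tq] := T10_quotient_trivial k; exists (T10 k).
  split; [exact: T10_is_T10 | exact: trivial_simple tq | exact: trivial_highest_weight tq].
have [f fE] := verma_e_counit k; have th := head_verma_e_trivial fE.
split; first exact: trivial_restr th.
(* Head and socle of M(e,+) are both lines with counit action. *)
by have [q tq] := socle_verma_e_trivial k; apply: trivial_isom th tq.
Qed.
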